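(* Every holomorphic function $f$ on $\mathscr U=\mathbb R_+^2\times\mathscr H_1\times\mathscr H_2$ satisfies the heat equations $$\Big(\frac{\partial}{\partial t_\alpha}+\triangle_\alpha\Big)f=0\quad\text{on }\mathscr U,\qquad\alpha=1,2.$$
   Context: For $\alpha=1,2$ let $n_\alpha\ge1$ and let $\mathscr H_\alpha=\mathbb R\times\mathbb C^{n_\alpha}$ be the Heisenberg group with points $(s_\alpha,\mathbf z_\alpha)$ and multiplication $(s_\alpha,\mathbf z_\alpha)(s_\alpha',\mathbf z_\alpha')=(s_\alpha+s_\alpha'+2\,\mathrm{Im}\langle\mathbf z_\alpha,\mathbf z_\alpha'\rangle,\mathbf z_\alpha+\mathbf z_\alpha')$, where $\langle\mathbf z,\mathbf z'\rangle=\sum_jz_j\overline{z_j'}$. With $z_{\alpha j}=x_{\alpha j}+\mathbf i x_{\alpha(n_\alpha+j)}$, put $X_{\alpha j}=\partial_{x_{\alpha j}}+2x_{\alpha(n_\alpha+j)}\partial_{s_\alpha}$, $X_{\alpha(n_\alpha+j)}=\partial_{x_{\alpha(n_\alpha+j)}}-2x_{\alpha j}\partial_{s_\alpha}$ for $1\le j\le n_\alpha$, and let $\triangle_\alpha=-\frac1{4n_\alpha}\sum_{j=1}^{2n_\alpha}X_{\alpha j}^2$ be the sub-Laplacian on $\mathscr H_\alpha$. $\mathscr U=\mathbb R_+^2\times\mathscr H_1\times\mathscr H_2$ ($\mathbb R_+=(0,\infty)$) has points $(t_1,t_2,\mathbf g_1,\mathbf g_2)$, $\mathbf g_\alpha=(s_\alpha,\mathbf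 z_\alpha)$, also written $(w_1,w_2,\mathbf z_1,\mathbf z_2)$ with $w_\alpha=s_\alpha+\mathbf i t_\alpha$. Let $\mathcal U=\mathcal U_1\times\mathcal U_2$ with $\mathcal U_\alpha=\{(\widetilde w_\alpha,\widetilde{\mathbf z}_\alpha)\in\mathbb C\times\mathbb C^{n_\alpha}:\mathrm{Im}\,\widetilde w_\alpha>|\widetilde{\mathbf z}_\alpha|^2\}$, and let $\pi:\mathscr U\to\mathcal U$ be the diffeomorphism $(w_1,w_2,\mathbf z_1,\mathbf z_2)\mapsto(w_1+\mathbf i|\mathbf z_1|^2,w_2+\mathbf i|\mathbf z_2|^2,\mathbf z_1,\mathbf z_2)$. A function $f$ on $\mathscr U$ is called holomorphic if $f\circ\pi^{-1}$ is holomorphic on $\mathcal U$ in the usual sense. *)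

(* Defs.v *)
From HB Require Import structures.
From mathcomp Require Import all_boot all_order all_algebra.
From mathcomp Require Import complex.
From mathcomp Require Import all_classical all_reals.
From mathcomp Require Import topology normedtype derive.

Set Implicit Arguments.
Unset Strict Implicit.
Unset Printing Implicit Defensive.

Import Order.TTheory GRing.Theory Num.Theory.
Import numFieldNormedType.Exports.

Local Open Scope classical_set_scope.
Local Open Scope ring_scope.

(* R[i] packed as a numFieldType, so that MathComp-Analysis equips it (and the
   products and row vectors built from it) with the norm and the differential
   calculus over the complex scalars. *)
Definition Cplx (R : realType) : numFieldType := (R[i])%type.

(* (s, x), where x lists the 2n real coordinates of z in C^n. *)
Definition heis (R : realType) (n : nat) : normedModType R :=
  (R * 'rV[R]_(n + n))%type.

(* (((t1, t2), g1), g2) *)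
Definition Uspace (R : realType) (n1 n2 : nat) : normedModType R :=
  (R * R * heis R n1 * heis R n2)%type.

(* (((w1, w2), z1), z2) *)
Definition Cspace (R : realType) (n1 n2 : nat) : normedModType (Cplx R) :=
  (Cplx R * Cplx R * 'rV[Cplx R]_n1 * 'rV[Cplx R]_n2)%type.

Section Points.
Context {R : realType}.
Local Notation C := (Cplx R).

Definition CRe (z : C) : R := complex.Re z.
Definition CIm (z : C) : R := complex.Im z.
Definition mkC (a b : R) : C := Complex a b.

Definition zvec n (x : 'rV[R]_(n + n)) : 'rV[C]_n :=
  \row_j mkC (x 0 (lshift n j)) (x 0 (rshift n j)).

Definition xvec n (z : 'rV[C]_n) : 'rV[R]_(n + n) :=
  row_mx (\row_j CRe (z 0 j)) (\row_j CIm (z 0 j)).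

(* The library norm of a row vector is the sup norm; this is |z|^2 for the
   Hermitian norm. *)
Definition hnorm2 n (z : 'rV[C]_n) : R :=
  \sum_j (CRe (z 0 j) ^+ 2 + CIm (z 0 j) ^+ 2).

Definition scrU n1 n2 : set (Uspace R n1 n2) :=
  [set p | let: (t1, t2, _, _) := p in 0 < t1 /\ 0 < t2].

Definition calU n1 n2 : set (Cspace R n1 n2) :=
  [set q | let: (w1, w2, z1, z2) := q in
     hnorm2 z1 < CIm w1 /\ hnorm2 z2 < CIm w2].

Definition piU n1 n2 (p : Uspace R n1 n2) : Cspace R n1 n2 :=
  let: (t1, t2, (s1, x1), (s2, x2)) := p in
  (mkC s1 (t1 + hnorm2 (zvec x1)), mkC s2 (t2 + hnorm2 (zvec x2)),
   zvec x1, zvec x2).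

Definition piUinv n1 n2 (q : Cspace R n1 n2) : Uspace R n1 n2 :=
  let: (w1, w2, z1, z2) := q in
  (CIm w1 - hnorm2 z1, CIm w2 - hnorm2 z2,
   (CRe w1, xvec z1), (CRe w2, xvec z2)).

Lemma zvecK n : cancel (@zvec n) (@xvec n).
Proof.
by move=> x; apply/rowP => k; rewrite mxE; case: splitP => j kj; rewrite !mxE /=;
  congr (x _ _); apply/val_inj.
Qed.

Lemma xvecK n : cancel (@xvec n) (@zvec n).
Proof.
move=> z; apply/rowP => j; rewrite mxE row_mxEl row_mxEr !mxE.
by rewrite /CRe /CIm /mkC; case: (z 0 j).
Qed.

Lemma piUK n1 n2 : cancel (@piU n1 n2) (@piUinv n1 n2).
Proof. by move=> [[[t1 t2] [s1 x1]] [s2 x2]] /=; rewrite !addrK !zvecK. Qed.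

Lemma piUinvK n1 n2 : cancel (@piUinv n1 n2) (@piU n1 n2).
Proof.
move=> [[[w1 w2] z1] z2] /=; rewrite !xvecK !subrK.
by rewrite /mkC /CRe /CIm; case: w1; case: w2.
Qed.

Lemma piU_calU n1 n2 (p : Uspace R n1 n2) : calU (piU p) <-> scrU p.
Proof.
case: p => [[[t1 t2] [s1 x1]] [s2 x2]] /=.
by rewrite !ltrDr.
Qed.

(* [differentiable] is taken over C: the differential is complex linear. *)
Definition holomorphic_on (V : normedModType C) (D : set V) (F : V -> C) :=
  forall q, D q -> differentiable F q.

Definition holomorphicU n1 n2 (f : Uspace R n1 n2 -> C) :=
  holomorphic_on (@calU n1 n2) (f \o @piUinv n1 n2).

End Points.

(* Derivatives of complex-valued functions of real variables are taken
   componentwise. *)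
Section RealDerivatives.
Context {R : realType} {V : normedModType R}.
Local Notation C := (Cplx R).

Definition cderivable (f : V -> C) (p v : V) : Prop :=
  derivable (CRe \o f) p v /\ derivable (CIm \o f) p v.

Definition cderive (f : V -> C) (p v : V) : C :=
  mkC ('D_v (CRe \o f) p) ('D_v (CIm \o f) p).

End RealDerivatives.

(* Calculus in one factor R x H_n, written (t, (s, x)), of a space V: [incl] is
   the linear inclusion of the factor into V, and [xcoord] reads the
   coordinates x of a point of V. *)
Section Factor.
Context {R : realType} {V : normedModType R} {n : nat}.
Context (incl : R * heis R n -> V) (xcoord : V -> 'rV[R]_(n + n)).
Local Notation C := (Cplx R).

Definition dir_t : V := incl (1, (0, 0)).
Definition dir_s : V := incl (0, (1, 0)).
Definition dir_x (k : 'I_(n + n)) : V := incl (0, (0, delta_mx 0 k)).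

Definition Xcoef (k : 'I_(n + n)) (p : V) : R :=
  match fintype.split k with
  | inl j => 2 * xcoord p 0 (rshift n j)
  | inr j => - (2 * xcoord p 0 (lshift n j))
  end.

Definition Xfield (k : 'I_(n + n)) (f : V -> C) (p : V) : C :=
  cderive f p (dir_x k) + mkC (Xcoef k p) 0 * cderive f p dir_s.

Definition subLaplacian (f : V -> C) (p : V) : C :=
  - (4 * n%:R)^-1 * \sum_(k < n + n) Xfield k (Xfield k f) p.

(* The limits defining derivatives are total in the library, so the existence of
   every partial derivative occurring in the equation is part of the claim. *)
Definition satisfies_heat (D : set V) (f : V -> C) : Prop :=
  forall p, D p ->
    [/\ cderivable f p dir_t,
        cderivable f p dir_s,
        forall k, cderivable f p (dir_x k),
        forall k, cderivable (Xfield k f) p dir_s /\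
                  cderivable (Xfield k f) p (dir_x k)
      & cderive f p dir_t + subLaplacian f p = 0].

End Factor.

Section Factors.
Context {R : realType} (n1 n2 : nat).

Definition incl1 (q : R * heis R n1) : Uspace R n1 n2 := (q.1, 0, q.2, 0).
Definition incl2 (q : R * heis R n2) : Uspace R n1 n2 := (0, q.1, 0, q.2).

Definition xcoord1 (p : Uspace R n1 n2) : 'rV[R]_(n1 + n1) :=
  let: (_, _, (_, x1), _) := p in x1.
Definition xcoord2 (p : Uspace R n1 n2) : 'rV[R]_(n2 + n2) :=
  let: (_, _, _, (_, x2)) := p in x2.

End Factors.

(* Main.v *)
Require Import Defs.
From mathcomp Require Import all_boot all_order all_algebra.
From mathcomp Require Import complex.
From mathcomp Require Import all_classical all_reals.
From mathcomp Require Import topology normedtype derive.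
From mathcomp Require Import sequences realfun exp trigo.
From mathcomp Require Import measure lebesgue_measure lebesgue_integral ftc.
From mathcomp Require Import ring lra.

(* In the coordinates of [calU], with [V_j = d/dz_j + 2 i (conj z_j) d/dw], a
   holomorphic [f] satisfies [d_t f = i F_w], [d_s f = F_w], [X_j f = V_j F] and
   [X_(n+j) f = i V_j F].  Since [X_j + i X_(n+j)] kills holomorphic functions,
   [X_j^2 f + X_(n+j)^2 f] reduces to [2 i (X_j + i X_(n+j)) (conj z_j) F_w =
   4 i F_w]; summing over [j] gives the heat equation.

   What has to be built is that the mere existence of the complex differential
   implies that [F_w] and [F_(z_j)] are again differentiable.  Goursat's
   bisection argument in logarithmic polar coordinates shows that the mean of
   [(f(z) - f(0)) / z] over the circle [|z| = s] does not depend on [s]; letting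
   [s] tend to [0] bounds [f'(0)] by the supremum of [f].  This Cauchy estimate,
   applied to increments of [f], yields a quantitative second-order Taylor
   bound, and applied to difference quotients in a second variable it shows that
   they are uniformly Cauchy together with their derivatives. *)

Set Implicit Arguments.
Unset Strict Implicit.
Unset Printing Implicit Defensive.

Import Order.TTheory GRing.Theory Num.Theory.
Import numFieldNormedType.Exports.

Local Open Scope classical_set_scope.
Local Open Scope ring_scope.

(** * Goursat's theorem on rectangles *)

Section RealGoursat.
Context {R : realType}.
Implicit Types (P Q : R -> R -> R).

(** The fundamental theorem of calculus for the Lebesgue integral. The derivative is obtained only
    in the open interval, so later uses start from a slightly larger segment. *)
Lemma primitive_exists (g : R -> R) (a b : R) :
  (forall x, a <= x <= b -> {for x, continuous g}) ->
  exists G, forall x, a < x < b -> is_derive x 1 G (g x).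
Proof.
move=> cg.
have ig : (@lebesgue_measure R).-integrable `[a, b] (EFin \o g).
  apply: continuous_compact_integrable; first exact: segment_compact.
  by apply: continuous_in_subspaceT => x; rewrite inE /= in_itv => /cg.
eexists => x /andP[ax xb].
have cx : {for x, continuous g} by apply: cg; rewrite !ltW.
have [dG G'] := continuous_FTC1_closed xb ig ax cx.
by apply: DeriveDef; [exact: dG | rewrite -derive1E].
Qed.

(** By the mean value theorem the increment of [G] is [g x * (b - a)] for some [x]. This replaces
    estimates of integrals throughout: integrals occur only as increments of primitives. *)
Lemma mean_value_bound (G g : R -> R) (a b c e : R) : a <= b ->
  (forall x, a <= x <= b -> is_derive x 1 G (g x)) ->
  (forall x, a <= x <= b -> `|g x - c| <= e) ->
  `|G b - G a - c * (b - a)| <= e * (b - a).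
Proof.
move=> ab dG gc.
have [||x xab ->] := @MVT_segment R G g a b ab.
- by move=> x /itvP xab; apply: dG; rewrite !xab.
- apply: continuous_in_subspaceT => x; rewrite inE /= in_itv => /dG ?.
  exact/differentiable_continuous/derivable1_diffP.
- rewrite -mulrBl normrM (ger0_norm (_ : 0 <= b - a)) ?subr_ge0//.
  by apply: ler_wpM2r; rewrite ?subr_ge0 ?gc // !(itvP xab).
Qed.

(** The supremum of the left endpoints works, since every right endpoint bounds all of them. *)
Lemma nested_intervals (a b : nat -> R) :
  (forall n, a n <= b n) -> (forall n, a n <= a n.+1) ->
  (forall n, b n.+1 <= b n) -> exists x, forall n, a n <= x <= b n.
Proof.
move=> ab ai bd.
have am n k : a n <= a (n + k)%N.
  by elim: k => [|k IH]; rewrite ?addn0// addnS (le_trans IH).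
have bm n k : b (n + k)%N <= b n.
  by elim: k => [|k IH]; rewrite ?addn0// addnS (le_trans _ IH).
have aub m n : a m <= b n.
  by rewrite (le_trans (am m n))// (le_trans (ab _))// addnC.
exists (sup (range a)) => n; apply/andP; split.
  apply: ub_le_sup; last by exists n.
  by exists (b 0%N) => _ [m _ <-].
apply: ge_sup; first by exists (a 0%N), 0%N.
by move=> _ [m _ <-].
Qed.

(** Real total differentiability at one point, with the remainder measured against the sum norm. *)
Definition linapprox P (x y p q : R) := forall e, 0 < e -> exists2 d, 0 < d &
  forall x' y', `|x' - x| < d -> `|y' - y| < d ->
  `|P x' y' - P x y - (p * (x' - x) + q * (y' - y))| <=
    e * (`|x' - x| + `|y' - y|).

Section Rectangle.
Variables (P Q GP GQ : R -> R -> R).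

(* With primitives [GP s] of [P ^~ s] and [GQ t] of [Q t], this is the integral
   of [P dx + Q dy] along the boundary of [[a, b] x [c, d]]. *)
Definition loop a b c d : R :=
  (GP c b - GP c a) - (GP d b - GP d a)
  + (GQ b d - GQ b c) - (GQ a d - GQ a c).

(** Cutting at both midpoints, the inner edges cancel and the four quarter loops add up to the
    whole; one of them carries at least a quarter of its absolute value. *)
Lemma loop_quarter a b c d : a <= b -> c <= d ->
  exists r : R * R * R * R, let: (a', b', c', d') := r in
  [/\ a <= a' /\ b' <= b, c <= c' /\ d' <= d,
      b' - a' = (b - a) / 2, d' - c' = (d - c) / 2 &
      `|loop a b c d| <= 4 * `|loop a' b' c' d'|].
Proof.
move=> ab cd; pose m := (a + b) / 2; pose n := (c + d) / 2.
have LE : loop a b c d = loop a m c n + loop m b c n + loop a m n d + loop m b n d.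
  by rewrite /loop; ring.
have : `|loop a b c d| <= 4 * `|loop a m c n| \/
  `|loop a b c d| <= 4 * `|loop m b c n| \/
  `|loop a b c d| <= 4 * `|loop a m n d| \/
  `|loop a b c d| <= 4 * `|loop m b n d|.
  have := ler_normD (loop a m c n + loop m b c n + loop a m n d) (loop m b n d).
  have := ler_normD (loop a m c n + loop m b c n) (loop a m n d).
  have := ler_normD (loop a m c n) (loop m b c n).
  rewrite -LE => h1 h2 h3.
  case: (leP `|loop a b c d| (4 * `|loop a m c n|)) => ?; first by left.
  case: (leP `|loop a b c d| (4 * `|loop m b c n|)) => ?; first by right; left.
  case: (leP `|loop a b c d| (4 * `|loop a m n d|)) => ?.
    by right; right; left.
  by right; right; right; lra.
by case=> [?|[?|[?|?]]]; [exists (a, m, c, n)|exists (m, b, c, n)|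
  exists (a, m, n, d)|exists (m, b, n, d)];
  split => //; rewrite /m /n; try split; lra.
Qed.

(** The coefficient [k] is shared: it is both the [y]-slope of [P] and the [x]-slope of [Q]. Pairing
    opposite sides, the affine parts contribute [k * (c - d) * (b - a)] and [k * (b - a) * (d - c)],
    which cancel, and only the remainders are left. *)
Lemma loop_small (a b c d x y p k q e r : R) : a <= b -> c <= d ->
  (forall t s : R, a <= t <= b -> is_derive t 1 (GP s) (P t s)) ->
  (forall t s : R, a <= t <= b -> c <= s <= d -> is_derive s 1 (GQ t) (Q t s)) ->
  a <= x <= b -> c <= y <= d -> 0 < e -> b - a < r -> d - c < r ->
  (forall t s, `|t - x| < r -> `|s - y| < r ->
    `|P t s - P x y - (p * (t - x) + k * (s - y))| <= e * (`|t - x| + `|s - y|)) ->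
  (forall t s, `|t - x| < r -> `|s - y| < r ->
    `|Q t s - Q x y - (k * (t - x) + q * (s - y))| <= e * (`|t - x| + `|s - y|)) ->
  `|loop a b c d| <= 2 * e * (b - a + (d - c)) ^+ 2.
Proof.
move=> ab cd dP dQ xab ycd e0 abr cdr hP hQ.
have H1 t s : a <= t <= b -> c <= s <= d ->
    `|t - x| < r /\ `|s - y| < r /\
    e * (`|t - x| + `|s - y|) <= e * (b - a + (d - c)).
  move=> tab scd; have : `|t - x| <= b - a by rewrite ler_norml; lra.
  have : `|s - y| <= d - c by rewrite ler_norml; lra.
  by move=> ? ?; rewrite ler_pM2l//; lra.
have bP : `|(GP c b - GP d b) - (GP c a - GP d a) - (k * (c - d)) * (b - a)| <=
    2 * e * (b - a + (d - c)) * (b - a).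
  apply: (@mean_value_bound (fun t => GP c t - GP d t) (fun t => P t c - P t d)) => //.
    by move=> t tab; have ? := dP t c tab; have ? := dP t d tab; apply: is_deriveB.
  move=> t tab; have := H1 t c tab; have := H1 t d tab.
  case=> [|td [rd ed]]; first lra.
  case=> [|tc [rc ec]]; first lra.
  have := hP _ _ td rd; have := hP _ _ tc rc.
  by rewrite !ler_norml; lra.
have bQ : `|(GQ b d - GQ a d) - (GQ b c - GQ a c) - (k * (b - a)) * (d - c)| <=
    2 * e * (b - a + (d - c)) * (d - c).
  apply: (@mean_value_bound (fun t => GQ b t - GQ a t) (fun t => Q b t - Q a t)) => //.
    move=> t tab; have ? : is_derive t 1 (GQ b) (Q b t) by apply: dQ => //; lra.
    have ? : is_derive t 1 (GQ a) (Q a t) by apply: dQ => //; lra.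
    exact: is_deriveB.
  move=> t tab.
  have [|//|td [rd ed]] := H1 a t; first lra.
  have [|//|tc [rc ec]] := H1 b t; first lra.
  have := hQ _ _ td rd; have := hQ _ _ tc rc.
  by rewrite !ler_norml; lra.
move: bP bQ; rewrite !ler_norml /loop; lra.
Qed.

End Rectangle.

(** Bisection: the [n]-th nested rectangle keeps at least [4 ^- n] of the loop, while [loop_small]
    at the common point bounds its loop by [4 ^- n] times an arbitrarily small constant. Closedness
    of the form enters pointwise through the shared [k], with no continuity of partial
    derivatives. *)
Lemma goursat P Q (GP GQ : R -> R -> R) (a b c d X : R) : a <= b -> c <= d -> b < X ->
  (forall x y, x < X -> exists p k q, linapprox P x y p k /\ linapprox Q x y k q) ->
  (forall t s : R, a <= t <= b -> is_derive t 1 (GP s) (P t s)) ->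
  (forall t s : R, a <= t <= b -> c <= s <= d -> is_derive s 1 (GQ t) (Q t s)) ->
  loop GP GQ a b c d = 0.
Proof.
move=> ab cd bX H dP dQ.
have /choice[f fP] : forall s : R * R * R * R, exists r : R * R * R * R,
  let: (a, b, c, d) := s in let: (a', b', c', d') := r in a <= b -> c <= d ->
  [/\ a <= a' /\ b' <= b, c <= c' /\ d' <= d,
      b' - a' = (b - a) / 2, d' - c' = (d - c) / 2 &
      `|loop GP GQ a b c d| <= 4 * `|loop GP GQ a' b' c' d'|].
  (* The selection function has to be total; quadruples that are not rectangles get a dummy
     value. *)
  move=> [[[a1 b1] c1] d1].
  have [ab1|?] := leP a1 b1; last by exists (0, 0, 0, 0).
  have [cd1|?] := leP c1 d1; last by exists (0, 0, 0, 0).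
  by have [[[[a2 b2] c2] d2] h] := loop_quarter GP GQ ab1 cd1; exists (a2, b2, c2, d2).
pose s n := iter n f (a, b, c, d).
pose A n := (s n).1.1.1; pose B n := (s n).1.1.2.
pose C n := (s n).1.2; pose D n := (s n).2.
have sS n : A n <= B n -> C n <= D n -> [/\ A n <= A n.+1 /\ B n.+1 <= B n,
   C n <= C n.+1 /\ D n.+1 <= D n,
   B n.+1 - A n.+1 = (B n - A n) / 2, D n.+1 - C n.+1 = (D n - C n) / 2 &
   `|loop GP GQ (A n) (B n) (C n) (D n)| <=
     4 * `|loop GP GQ (A n.+1) (B n.+1) (C n.+1) (D n.+1)|].
  rewrite /A /B /C /D /s iterS; move: (iter _ _ _) => u; have := fP u.
  by move: u (f u) => [[[? ?] ?] ?] [[[? ?] ?] ?].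
have ord n : A n <= B n /\ C n <= D n.
  elim: n => [|n [h1 h2]]; first by [].
  by have [_ _ ? ? _] := sS n h1 h2; split; lra.
have st n := sS n (ord n).1 (ord n).2.
have [x xP] : exists x, forall n, A n <= x <= B n.
  by apply: nested_intervals => n; [case: (ord n)|case: (st n) => -[]..].
have [y yP] : exists y, forall n, C n <= y <= D n.
  by apply: nested_intervals => n; [case: (ord n)|case: (st n) => _ []..].
have wAB n : B n - A n = (b - a) / 2 ^+ n.
  elim: n => [|n IH]; first by rewrite expr0 divr1.
  by have [_ _ -> _ _] := st n; rewrite IH exprSr invfM mulrA.
have wCD n : D n - C n = (d - c) / 2 ^+ n.
  elim: n => [|n IH]; first by rewrite expr0 divr1.
  by have [_ _ _ -> _] := st n; rewrite IH exprSr invfM mulrA.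
have lP n : `|loop GP GQ a b c d| <= 4 ^+ n * `|loop GP GQ (A n) (B n) (C n) (D n)|.
  elim: n => [|n IH]; first by rewrite mul1r.
  have [_ _ _ _ h] := st n; apply: (le_trans IH).
  by rewrite exprSr -mulrA ler_pM2l ?exprn_gt0.
have sub n : a <= A n /\ B n <= b /\ c <= C n /\ D n <= d.
  elim: n => [|n [? [? [? ?]]]]; first by rewrite /A /B /C /D /= !lexx.
  by have [[? ?] [? ?] _ _ _] := st n; lra.
have xX : x < X by have := xP 0%N; rewrite /A /B /=; lra.
have [p [k [q [lp lq]]]] := H x y xX.
have main e : 0 < e -> `|loop GP GQ a b c d| <= 2 * e * (b - a + (d - c)) ^+ 2.
  move=> e0; have [r1 r10 h1] := lp _ e0; have [r2 r20 h2] := lq _ e0.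
  pose r := Num.min r1 r2.
  have r0 : 0 < r by rewrite lt_min r10 r20.
  (* The exponent is taken above the quotient of the side sum by [r], and [2 ^+ n] exceeds [n]. *)
  have [n nP] : exists n, (b - a + (d - c)) / 2 ^+ n < r.
    pose m := Num.truncn ((b - a + (d - c)) / r); exists m.+1.
    rewrite ltr_pdivrMr ?exprn_gt0// mulrC -ltr_pdivrMr//.
    apply: (lt_trans (truncnS_gt _)); rewrite -natrX ltr_nat.
    exact: ltn_expl.
  have [? [? [? ?]]] := sub n.
  have := @loop_small P Q GP GQ (A n) (B n) (C n) (D n) x y p k q e r (ord n).1 (ord n).2.
  have bd0 : 0 <= (d - c) / 2 ^+ n by rewrite divr_ge0 ?exprn_ge0 ?subr_ge0.
  have ba0 : 0 <= (b - a) / 2 ^+ n by rewrite divr_ge0 ?exprn_ge0 ?subr_ge0.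
  rewrite mulrDl in nP.
  move=> /(_ _ _ (xP n) (yP n) e0 _ _) h.
  apply: (le_trans (lP n)).
  have -> : 2 * e * (b - a + (d - c)) ^+ 2 =
     4 ^+ n * (2 * e * (B n - A n + (D n - C n)) ^+ 2).
    have -> : (4 : R) ^+ n = 2 ^+ n ^+ 2.
      by rewrite -exprM mulnC exprM; congr (_ ^+ _); ring.
    rewrite wAB wCD; have : (2 : R) ^+ n != 0 by rewrite expf_neq0 ?pnatr_eq0.
    by move: (2 ^+ n) => u u0; field.
  rewrite ler_pM2l ?exprn_gt0//; apply: h.
  - move=> t u /andP[? ?].
    by apply: dP; apply/andP; split; apply: le_trans; eassumption.
  - move=> t u /andP[? ?] /andP[? ?].
    by apply: dQ; apply/andP; split; apply: le_trans; eassumption.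
  - by rewrite wAB; lra.
  - by rewrite wCD; lra.
  - by move=> t u tr ur; apply: h1;
      rewrite (lt_le_trans tr, lt_le_trans ur) ?ge_min ?lexx ?orbT.
  - by move=> t u tr ur; apply: h2;
      rewrite (lt_le_trans tr, lt_le_trans ur) ?ge_min ?lexx ?orbT.
apply/normr0_eq0/eqP; rewrite eq_le normr_ge0 andbT.
apply/ler_addgt0Pl => e e0; rewrite addr0.
have := sqr_ge0 (b - a + (d - c)); move: main; set S := _ ^+ 2 => main S0.
(* [S] vanishes for a degenerate rectangle, hence the division by [S + 1]. *)
have := main (e / (2 * (S + 1))); rewrite divr_gt0//; last by lra.
move=> /(_ isT) h; apply: (le_trans h).
have -> : 2 * (e / (2 * (S + 1))) * S = e * (S / (S + 1)) by field; lra.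
by apply: ler_piMr; [exact: ltW|rewrite ler_pdivrMr; lra].
Qed.

End RealGoursat.

(** * Complex differentiation and Cauchy's estimate *)

Section ComplexCalculus.
Context {R : realType}.
Local Notation C := (Cplx R).
Implicit Types (z w h c : C) (f g : C -> C).

(** The norm on [C] takes its values in [C]; its real part carries the same information and keeps
    all estimates in the ordered field [R]. *)
Definition cmod z : R := CRe `|z|.

Lemma cmodE z : `|z| = mkC (cmod z) 0.
Proof. by rewrite /cmod /CRe normc_def. Qed.

Lemma cmodEsqrt z : cmod z = Num.sqrt (CRe z ^+ 2 + CIm z ^+ 2).
Proof. by rewrite /cmod /CRe normc_def. Qed.

Lemma mkCK z : mkC (CRe z) (CIm z) = z. Proof. by case: z. Qed.

Lemma CReD z w : CRe (z + w) = CRe z + CRe w. Proof. by case: z; case: w. Qed.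
Lemma CImD z w : CIm (z + w) = CIm z + CIm w. Proof. by case: z; case: w. Qed.
Lemma CReN z : CRe (- z) = - CRe z. Proof. by case: z. Qed.
Lemma CImN z : CIm (- z) = - CIm z. Proof. by case: z. Qed.
Lemma CReM z w : CRe (z * w) = CRe z * CRe w - CIm z * CIm w.
Proof. by case: z; case: w. Qed.
Lemma CImM z w : CIm (z * w) = CRe z * CIm w + CIm z * CRe w.
Proof. by case: z; case: w. Qed.

Definition CE := (CReD, CImD, CReN, CImN, CReM, CImM).

Lemma Cext z w : CRe z = CRe w -> CIm z = CIm w -> z = w.
Proof. by case: z; case: w => ? ? ? ? /= -> ->. Qed.

Lemma cmod_ge0 z : 0 <= cmod z. Proof. by rewrite cmodEsqrt sqrtr_ge0. Qed.
Lemma cmodM z w : cmod (z * w) = cmod z * cmod w.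
Proof. by rewrite /cmod normrM !cmodE CReM /= mulr0 subr0. Qed.
Lemma cmodN z : cmod (- z) = cmod z. Proof. by rewrite /cmod normrN. Qed.
Lemma cmodB z w : cmod (z - w) = cmod (w - z). Proof. by rewrite /cmod distrC. Qed.
Lemma cmodD z w : cmod (z + w) <= cmod z + cmod w.
Proof. by have := ler_normD z w; rewrite !cmodE lecE => /andP[]. Qed.
Lemma cmod0 : cmod 0 = 0. Proof. by rewrite /cmod normr0. Qed.
Lemma cmod1 : cmod 1 = 1. Proof. by rewrite /cmod normr1. Qed.
Lemma cmod_eq0 z : (cmod z == 0) = (z == 0).
Proof. by rewrite -[RHS]normr_eq0 cmodE eq_complex /= eqxx andbT. Qed.
Lemma cmod_gt0 z : (0 < cmod z) = (z != 0).
Proof. by rewrite lt_neqAle cmod_ge0 andbT eq_sym cmod_eq0. Qed.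
Lemma cmodV z : cmod z^-1 = (cmod z)^-1.
Proof.
have [->|z0] := eqVneq z 0; first by rewrite invr0 cmod0 invr0.
apply: (@mulfI _ (cmod z)); first by rewrite cmod_eq0.
by rewrite -cmodM !divff ?cmod_eq0 // cmod1.
Qed.
Lemma cmod_real (x : R) : cmod (mkC x 0) = `|x|.
Proof. by rewrite cmodEsqrt expr0n addr0 sqrtr_sqr. Qed.
Lemma cmod_imag (x : R) : cmod (mkC 0 x) = `|x|.
Proof. by rewrite cmodEsqrt expr0n add0r sqrtr_sqr. Qed.
Lemma CRe_le z : `|CRe z| <= cmod z.
Proof.
rewrite cmodEsqrt -sqrtr_sqr ler_sqrt ?addr_ge0 ?sqr_ge0//.
by rewrite lerDl sqr_ge0.
Qed.
Lemma CIm_le z : `|CIm z| <= cmod z.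
Proof.
rewrite cmodEsqrt -sqrtr_sqr ler_sqrt ?addr_ge0 ?sqr_ge0//.
by rewrite lerDr sqr_ge0.
Qed.
Lemma cmod_le z : cmod z <= `|CRe z| + `|CIm z|.
Proof.
have {1}-> : z = mkC (CRe z) 0 + mkC 0 (CIm z).
  by apply: Cext; rewrite CE /= ?addr0 ?add0r.
by rewrite (le_trans (cmodD _ _))// cmod_real cmod_imag.
Qed.

(** Complex differentiability with the derivative as an explicit argument and without division, so
    that [h = 0] needs no exception. *)
Definition cdiff f z c := forall e : R, 0 < e -> exists2 d : R, 0 < d &
  forall h, cmod h < d -> cmod (f (z + h) - f z - c * h) <= e * cmod h.

Lemma cdiff_lip f z c : cdiff f z c -> exists2 d : R, 0 < d &
  forall h, cmod h < d -> cmod (f (z + h) - f z) <= (cmod c + 1) * cmod h.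
Proof.
move=> /(_ 1 ltr01)[d d0 H]; exists d => // h /H hd.
rewrite -(subrK (c * h) (f (z + h) - f z)) (le_trans (cmodD _ _))//.
by rewrite cmodM mulrDl addrC lerD2l.
Qed.

Lemma cdiff_ext f g z c : f =1 g -> cdiff f z c -> cdiff g z c.
Proof.
move=> fg H e e0; have [d d0 h] := H e e0.
by exists d => // k kd; rewrite -!fg; exact: h.
Qed.

Lemma cdiff_eq f g z c c' : cdiff f z c -> f =1 g -> c = c' -> cdiff g z c'.
Proof. by move=> h fg <-; exact: cdiff_ext h. Qed.

Lemma cdiff_affine z a c : cdiff (fun h => a + c * h) z c.
Proof.
move=> e e0; exists 1 => // h _.
have -> : a + c * (z + h) - (a + c * z) - c * h = 0 by ring.
by rewrite cmod0; apply: mulr_ge0; [exact: ltW|exact: cmod_ge0].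
Qed.

Lemma cdiff_cst z a : cdiff (fun=> a) z 0.
Proof. by apply: (cdiff_eq (cdiff_affine z a 0)) => // y; rewrite mul0r addr0. Qed.

Lemma cdiffD f g z a b : cdiff f z a -> cdiff g z b ->
  cdiff (fun z => f z + g z) z (a + b).
Proof.
move=> hf hg e e0.
have [|d1 d10 h1] := hf (e / 2); first by rewrite divr_gt0.
have [|d2 d20 h2] := hg (e / 2); first by rewrite divr_gt0.
exists (Num.min d1 d2); first by rewrite lt_min d10.
move=> h; rewrite lt_min => /andP[/h1 k1 /h2 k2].
have -> : f (z + h) + g (z + h) - (f z + g z) - (a + b) * h =
   (f (z + h) - f z - a * h) + (g (z + h) - g z - b * h) by ring.
by apply: (le_trans (cmodD _ _)); lra.
Qed.

Lemma cdiffZ f z a k : cdiff f z a -> cdiff (fun z => k * f z) z (k * a).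
Proof.
move=> hf e e0.
have p : 0 < cmod k + 1 by rewrite ltr_wpDl// cmod_ge0.
have [|d d0 h] := hf (e / (cmod k + 1)); first by rewrite divr_gt0.
exists d => // x /h hx.
have -> : k * f (z + x) - k * f z - k * a * x = k * (f (z + x) - f z - a * x) by ring.
rewrite cmodM; apply: (@le_trans _ _ ((cmod k + 1) * (e / (cmod k + 1) * cmod x))).
  by apply: ler_pM; rewrite ?cmod_ge0//; lra.
by rewrite mulrA mulrCA divff ?mulr1// gt_eqF.
Qed.

Lemma cdiffB f g z a b : cdiff f z a -> cdiff g z b ->
  cdiff (fun z => f z - g z) z (a - b).
Proof.
move=> hf /(cdiffZ (-1)) hg; rewrite -(mulN1r b).
by apply: cdiff_ext (cdiffD hf hg) => x; rewrite mulN1r.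
Qed.

Lemma cdiff_comp f g z a b : cdiff g z b -> cdiff f (g z) a ->
  cdiff (fun z => f (g z)) z (a * b).
Proof.
move=> hg hf e e0; have [d1 d10 h1] := cdiff_lip hg.
have p : 0 < cmod b + 1 by rewrite ltr_wpDl// cmod_ge0.
have q : 0 < cmod a + 1 by rewrite ltr_wpDl// cmod_ge0.
have [|d2 d20 h2] := hf (e / 2 / (cmod b + 1)); first by rewrite !divr_gt0.
have [|d3 d30 h3] := hg (e / 2 / (cmod a + 1)); first by rewrite !divr_gt0.
exists (Num.min d1 (Num.min (d2 / (cmod b + 1)) d3)).
  by rewrite !lt_min d10 d30 divr_gt0.
move=> h; rewrite !lt_min ltr_pdivlMr// => /and3P[/h1 k1 k2 /h3 k3].
have kk : cmod (g (z + h) - g z) < d2 by rewrite (le_lt_trans k1)// mulrC.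
have := h2 _ kk; rewrite addrCA subrr addr0 => k4.
have -> : f (g (z + h)) - f (g z) - a * b * h =
   (f (g (z + h)) - f (g z) - a * (g (z + h) - g z)) +
   a * (g (z + h) - g z - b * h) by ring.
apply: (le_trans (cmodD _ _)); rewrite cmodM.
have E1 : cmod (f (g (z + h)) - f (g z) - a * (g (z + h) - g z)) <= e / 2 * cmod h.
  apply: (le_trans k4).
  have -> : e / 2 * cmod h = e / 2 / (cmod b + 1) * ((cmod b + 1) * cmod h).
    by rewrite mulrA divfK// gt_eqF.
  by rewrite ler_pM2l// !divr_gt0.
have E2 : cmod a * cmod (g (z + h) - g z - b * h) <= e / 2 * cmod h.
  apply: (@le_trans _ _ ((cmod a + 1) * (e / 2 / (cmod a + 1) * cmod h))).
    by apply: ler_pM; rewrite ?cmod_ge0//; lra.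
  by rewrite mulrA mulrCA divff ?mulr1// gt_eqF.
lra.
Qed.

Lemma cdiffM f g z a b : cdiff f z a -> cdiff g z b ->
  cdiff (fun z => f z * g z) z (a * g z + f z * b).
Proof.
move=> hf hg e e0.
have [d1 d10 h1] := cdiff_lip hf; have [d2 d20 h2] := cdiff_lip hg.
pose K := (cmod a + 1) * (cmod b + 1).
have K0 : 0 < K by rewrite mulr_gt0// ltr_wpDl// cmod_ge0.
have e3 : 0 < e / 3 by rewrite divr_gt0.
have [d3 d30 h3] := cdiffZ (g z) hf e3.
have [d4 d40 h4] := cdiffZ (f z) hg e3.
exists (Num.min (Num.min d1 d2) (Num.min (Num.min d3 d4) (e / 3 / K))).
  by rewrite !lt_min d10 d20 d30 d40 divr_gt0.
move=> h; rewrite !lt_min ltr_pdivlMr//.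
move=> /andP[/andP[/h1 k1 /h2 k2] /andP[/andP[/h3 k3 /h4 k4] k5]].
have -> : f (z + h) * g (z + h) - f z * g z - (a * g z + f z * b) * h =
  (g z * f (z + h) - g z * f z - g z * a * h) +
  (f z * g (z + h) - f z * g z - f z * b * h) +
  (f (z + h) - f z) * (g (z + h) - g z) by ring.
apply: (le_trans (cmodD _ _)); rewrite cmodM.
have k6 : cmod (f (z + h) - f z) * cmod (g (z + h) - g z) <= e / 3 * cmod h.
  apply: (@le_trans _ _ (((cmod a + 1) * cmod h) * ((cmod b + 1) * cmod h))).
    by apply: ler_pM; rewrite ?cmod_ge0.
  have -> : (cmod a + 1) * cmod h * ((cmod b + 1) * cmod h) = cmod h * K * cmod h.
    by rewrite /K; ring.
  by rewrite ler_wpM2r ?cmod_ge0// ltW.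
have := cmodD (g z * f (z + h) - g z * f z - g z * a * h)
  (f z * g (z + h) - f z * g z - f z * b * h).
lra.
Qed.

(** * The complex exponential and its derivative *)

Definition cexp z : C :=
  mkC (expR (CRe z) * cos (CIm z)) (expR (CRe z) * sin (CIm z)).

Lemma cexpD z w : cexp (z + w) = cexp z * cexp w.
Proof.
apply: Cext; rewrite /cexp !CE /= expRD ?cosD ?sinD; ring.
Qed.

Lemma cmod_cexp z : cmod (cexp z) = expR (CRe z).
Proof.
rewrite cmodEsqrt /= !exprMn -mulrDr cos2Dsin2 mulr1 sqrtr_sqr ger0_norm//.
exact: expR_ge0.
Qed.

Lemma cexp0 : cexp 0 = 1.
Proof. by apply: Cext; rewrite /= expR0 ?cos0 ?sin0 mul1r. Qed.

Lemma cexpN z : cexp z * cexp (- z) = 1.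
Proof. by rewrite -cexpD subrr cexp0. Qed.

Lemma is_derive_eps (g : R -> R) (x a : R) : is_derive x 1 g a -> forall e : R, 0 < e ->
  exists2 d : R, 0 < d & forall h : R, `|h| < d -> `|g (x + h) - g x - a * h| <= e * `|h|.
Proof.
move=> [dg <-] e e0.
have /= H : h^-1 *: (g (h *: 1 + x) - g x) @[h --> 0^'] --> 'D_1 g x by exact: dg.
move: H => /cvgrPdist_le /(_ e e0) /nbhs_ballP[d /= d0 H].
exists d => // h hd; have [->|h0] := eqVneq h 0.
  by rewrite addr0 subrr mulr0 subrr normr0 mulr0.
have := H h; rewrite /ball /= sub0r normrN => /(_ hd h0).
rewrite -(ler_pM2r (_ : 0 < `|h|)) ?normr_gt0// -normrM distrC.
by rewrite mulrBl [_%:A]mulr1 [h^-1 *: _]mulrC mulfVK// [h + x]addrC.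
Qed.

Lemma cdiff_cexp0 : cdiff cexp 0 1.
Proof.
(* With [m] the modulus of [h], the error is at most [4 * k * m] in the real part and [5 * k * m] in
   the imaginary part. The condition [k <= 1] gives the bounds [2 * m], and [m < k] handles the
   products. *)
move=> e e0; have [k [k0 ke ke1]] : exists k : R, [/\ 0 < k, k <= e / 9 & k <= 1].
  by exists (Num.min (e / 9) 1); split;
    rewrite ?lt_min ?ge_min ?lexx ?orbT ?ltr01 ?andbT ?divr_gt0.
have [d1 d10 h1] := is_derive_eps (is_derive_expR (0 : R)) k0.
have [d2 d20 h2] := is_derive_eps (is_derive_cos (0 : R)) k0.
have [d3 d30 h3] := is_derive_eps (is_derive_sin (0 : R)) k0.
exists (Num.min (Num.min d1 d2) (Num.min d3 k)).
  by rewrite !lt_min d10 d20 d30 k0.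
move=> h; rewrite !lt_min => /andP[/andP[k1 k2] /andP[k3 k4]].
have := CRe_le h; have := CIm_le h; case: h k1 k2 k3 k4 => a b /= + + + + hb ha.
set m := cmod _ in ha hb * => k1 k2 k3 k4.
have := h1 a (le_lt_trans ha k1); have := h2 b (le_lt_trans hb k2).
have := h3 b (le_lt_trans hb k3).
rewrite !add0r cexp0 sin0 cos0 expR0 oppr0 mul0r !mul1r !subr0 addr0 => s1 c1 e1.
have m0 : 0 <= m := cmod_ge0 _.
have T1 : k * `|a| <= k * m by rewrite ler_pM2l.
have T2 : k * `|b| <= k * m by rewrite ler_pM2l.
have T3 : k * m <= e / 9 * m by rewrite ler_wpM2r.
have T4 : k * m <= m by rewrite ler_piMl.
have E1 : `|expR a - 1| <= 2 * m.
  by rewrite -(subrK a (expR a - 1)) (le_trans (ler_normD _ _))//; lra.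
have S1 : `|sin b| <= 2 * m.
  by rewrite -(subrK b (sin b)) (le_trans (ler_normD _ _))//; lra.
apply: (le_trans (cmod_le _)); rewrite !CE /= subr0.
have -> : expR a * cos b - 1 - a =
  (expR a - 1 - a) + (expR a - 1) * (cos b - 1) + (cos b - 1) by ring.
have -> : expR a * sin b - b = (sin b - b) + (expR a - 1) * sin b by ring.
have Q1 : `|(expR a - 1) * (cos b - 1)| <= 2 * m * k.
  by rewrite normrM; apply: ler_pM => //; apply: (le_trans c1); lra.
have Q2 : `|(expR a - 1) * sin b| <= 2 * m * (2 * k).
  by rewrite normrM; apply: ler_pM => //; apply: (le_trans S1); lra.
have := ler_normD (expR a - 1 - a + (expR a - 1) * (cos b - 1)) (cos b - 1).
have := ler_normD (expR a - 1 - a) ((expR a - 1) * (cos b - 1)).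
have := ler_normD (sin b - b) ((expR a - 1) * sin b).
lra.
Qed.

Lemma cdiff_cexp z : cdiff cexp z (cexp z).
Proof.
move=> e e0; have [d d0 h] := cdiffZ (cexp z) cdiff_cexp0 e0.
exists d => // k /h; rewrite add0r cexp0 !mulr1 cexpD //.
Qed.

End ComplexCalculus.

Lemma eps_is_derive (R : realType) (V : normedModType R) (f : V -> R) p v a :
  (forall e : R, 0 < e -> exists2 d : R, 0 < d &
    forall h : R, `|h| < d -> `|f (p + h *: v) - f p - a * h| <= e * `|h|) ->
  is_derive p v f a.
Proof.
move=> H.
have cv : h^-1 *: (f (h *: v + p) - f p) @[h --> 0^'] --> a.
  apply/cvgrPdist_le => e e0; have [d d0 Hd] := H e e0.
  apply/nbhs_ballP; exists d => //= h; rewrite /ball /= sub0r normrN => hd h0.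
  rewrite -(ler_pM2r (_ : 0 < `|h|)) ?normr_gt0// -normrM mulrBl distrC.
  rewrite [h^-1 *: _]mulrC mulfVK// [_ + p]addrC.
  exact: Hd.
apply: DeriveDef; last exact: cvg_lim.
by apply/cvg_ex; exists a.
Qed.

(** * Cauchy's estimate through logarithmic polar coordinates *)

Section CauchyEstimate.
Context {R : realType}.
Local Notation C := (Cplx R).
Implicit Types (f g : C -> C) (z w c : C).

Lemma linapprox_derive (P : R -> R -> R) (x y p q : R) : linapprox P x y p q ->
  is_derive x 1 (P^~ y) p /\ is_derive y 1 (P x) q.
Proof.
move=> H; split; apply: eps_is_derive => e e0; have [d d0 h] := H e e0;
  exists d => // k kd.
- have := h (x + k) y; rewrite subrr normr0 addrAC subrr add0r mulr0 !addr0.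
  by rewrite [k *: 1]mulr1; apply.
- have := h x (y + k); rewrite subrr normr0 [y + k - y]addrAC subrr !add0r mulr0 !add0r.
  by rewrite [k *: 1]mulr1; apply.
Qed.

(** The Cauchy-Riemann equations: the [y]-slope of the imaginary part and the [x]-slope of the real
    part are both [CRe c]. Hence the imaginary part of [f dz], with [P] the imaginary and [Q] the
    real part of [f], is closed in the sense of [goursat]. *)
Lemma cdiff_linapprox f (x y : R) c : cdiff f (mkC x y) c ->
  linapprox (fun x y => CIm (f (mkC x y))) x y (CIm c) (CRe c) /\
  linapprox (fun x y => CRe (f (mkC x y))) x y (CRe c) (- CIm c).
Proof.
move=> H; have G (e : R) : 0 < e -> exists2 d : R, 0 < d & forall x' y' : R,
  `|x' - x| < d -> `|y' - y| < d ->
  cmod (f (mkC x' y') - f (mkC x y) - c * mkC (x' - x) (y' - y)) <=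
    e * (`|x' - x| + `|y' - y|).
  move=> e0; have [d d0 h] := H e e0; exists (d / 2); first by rewrite divr_gt0.
  move=> x' y' hx hy; have := cmod_le (mkC (x' - x) (y' - y)); rewrite /= => hc.
  have -> : mkC x' y' = mkC x y + mkC (x' - x) (y' - y).
    by apply: Cext; rewrite CE /= addrC subrK.
  apply: (le_trans (h _ _)); first lra.
  by rewrite ler_pM2l.
split=> e e0; have [d d0 h] := G e e0; exists d => // x' y' hx hy;
  apply: le_trans (h _ _ hx hy).
- by apply: le_trans (CIm_le _); rewrite !CE /= [CRe c * _ + _]addrC.
- by apply: le_trans (CRe_le _); rewrite !CE /= mulNr.
Qed.

(** Apply [goursat] to one period of the strip. The horizontal sides cancel by periodicity, so the
    integrals of the real part over the two vertical sides agree; they lie within [2 pi e0] of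
    [2 pi u0] and within [2 pi e1] of [2 pi u1]. *)
Lemma mean_const f (X x0 x1 u0 u1 e0 e1 : R) :
  (forall z, CRe z < X -> exists c, cdiff f z c) ->
  (forall z, f (z + mkC 0 (pi *+ 2)) = f z) -> x0 < x1 -> x1 < X ->
  (forall y, `|CRe (f (mkC x0 y)) - u0| <= e0) ->
  (forall y, `|CRe (f (mkC x1 y)) - u1| <= e1) -> `|u0 - u1| <= e0 + e1.
Proof.
move=> df per x01 x1X h0 h1.
pose P x y := CIm (f (mkC x y)); pose Q x y := CRe (f (mkC x y)).
have PQ x y : x < X -> exists p k q, linapprox P x y p k /\ linapprox Q x y k q.
  move=> xX; have [c /cdiff_linapprox H] := df (mkC x y) xX.
  by exists (CIm c), (CRe c), (- CIm c).
have tp : 0 < pi *+ 2 :> R by rewrite mulrn_wgt0// pi_gt0.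
have [GP GPP] : exists G : R -> R -> R, forall y t : R, x0 <= t <= x1 ->
    is_derive t 1 (G y) (P t y).
  suff : forall y : R, exists G : R -> R, forall t : R, x0 <= t <= x1 ->
    is_derive t 1 G (P t y) by move=> /choice[G GP]; exists G.
  (* The segment is enlarged on both sides but stays left of [X], which makes the primitive
     differentiable at [x0] and [x1] too. *)
  move=> y; pose b := (x1 + X) / 2.
  have [|G HG] := @primitive_exists R (P^~ y) (x0 - 1) b.
    move=> t tb; have [|p [k [q [/linapprox_derive[dP _] _]]]] := PQ t y.
      by rewrite /b in tb; lra.
    exact/differentiable_continuous/derivable1_diffP.
  by exists G => t tx; apply: HG; rewrite /b; lra.
have [GQ GQQ] : exists G : R -> R -> R, forall t y : R, x0 <= t <= x1 ->
    0 <= y <= pi *+ 2 -> is_derive y 1 (G t) (Q t y).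
  suff : forall t : R, exists G : R -> R, forall y : R, x0 <= t <= x1 ->
    0 <= y <= pi *+ 2 -> is_derive y 1 G (Q t y) by move=> /choice[G GQ]; exists G.
  move=> t; have [tX|tX] := boolP (x0 <= t <= x1); last by exists id.
  have [|G HG] := @primitive_exists R (Q t) (- 1) (pi *+ 2 + 1).
    move=> y yb; have [|p [k [q [_ /linapprox_derive[_ dQ]]]]] := PQ t y; first lra.
    exact/differentiable_continuous/derivable1_diffP.
  by exists G => y _ ty; apply: HG; lra.
have := @goursat R P Q GP GQ x0 x1 0 (pi *+ 2) X (ltW x01) (ltW tp) x1X PQ.
move=> /(_ (fun t s => GPP s t) GQQ); rewrite /loop.
(* By periodicity the integrand [P t 0 - P t (pi *+ 2)] vanishes, so the mean value bound holds with
   error [0]. *)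
have : `|(GP 0 x1 - GP (pi *+ 2) x1) - (GP 0 x0 - GP (pi *+ 2) x0)
    - 0 * (x1 - x0)| <= 0 * (x1 - x0).
  apply: (@mean_value_bound R (fun t => GP 0 t - GP (pi *+ 2) t)
    (fun t => P t 0 - P t (pi *+ 2))).
  - exact: ltW.
  - by move=> t tx; have ? := GPP 0 t tx; have ? := GPP (pi *+ 2) t tx; apply: is_deriveB.
  - move=> t tx; rewrite /P -[f (mkC t 0)]per subr0.
    have -> : mkC t 0 + mkC 0 (pi *+ 2) = mkC t (pi *+ 2).
      by apply: Cext; rewrite CE /= ?addr0 ?add0r.
    by rewrite subrr normr0.
rewrite !mul0r subr0 normr_le0 => /eqP zP.
have b1 : `|GQ x1 (pi *+ 2) - GQ x1 0 - u1 * (pi *+ 2 - 0)| <= e1 * (pi *+ 2 - 0).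
  apply: mean_value_bound (fun y _ => h1 y); first exact: ltW.
  by move=> y yp; apply: GQQ => //; rewrite lexx ltW.
have b0 : `|GQ x0 (pi *+ 2) - GQ x0 0 - u0 * (pi *+ 2 - 0)| <= e0 * (pi *+ 2 - 0).
  apply: mean_value_bound (fun y _ => h0 y); first exact: ltW.
  by move=> y yp; apply: GQQ => //; rewrite lexx ltW.
move=> lp; have E : GQ x1 (pi *+ 2) - GQ x1 0 = GQ x0 (pi *+ 2) - GQ x0 0.
  by move: zP lp; lra.
rewrite E in b1; move: b0 b1; rewrite subr0; move: (_ - GQ x0 0) => D b0 b1.
rewrite -(ler_pM2r tp) -[X in _ * X](gtr0_norm tp) -normrM.
by move: b0 b1; rewrite !ler_norml; lra.
Qed.

(** The function [F] is the difference quotient at [0] pulled back by the exponential, so vertical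
    lines are circles. On the circle of radius [s] it is within [e] of [f' 0]; on that of radius
    [r / 2] it is at most [2 M / (r / 2)]. [mean_const] compares the two. *)
Lemma cauchy_estimate_Re f f' (r M : R) : 0 < r ->
  (forall z, cmod z < r -> cdiff f z (f' z)) ->
  (forall z, cmod z < r -> cmod (f z) <= M) -> `|CRe (f' 0)| <= 4 * M / r.
Proof.
move=> r0 df fM.
have M0 : 0 <= M by apply: le_trans (cmod_ge0 _) (fM 0 _); rewrite cmod0.
pose F z := (f (cexp z) - f 0) * cexp (- z).
have expln x : (0 < x) -> expR (ln x) = x :> R by move=> x0; rewrite lnK.
apply/ler_addgt0Pl => e e0.
have c0 : cmod (0 : C) < r by rewrite cmod0.
have [d d0 hd] := df 0 c0 e e0.
(* The bound [d / 2] keeps the small circle where the derivative approximates the increment; [r / 4]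
   keeps it inside the circle of radius [r / 2]. *)
pose s := Num.min (d / 2) (r / 4).
have s0 : 0 < s by rewrite lt_min !divr_gt0.
have sd : s < d by rewrite gt_min; apply/orP; left; lra.
have sr : s < r / 2 by rewrite gt_min; apply/orP; right; lra.
have r2 : 0 < r / 2 by rewrite divr_gt0.
rewrite -[CRe _]subr0; apply: (@mean_const F (ln r) (ln s) (ln (r / 2))).
- move=> z zr; have Ez : cmod (cexp z) < r.
    by rewrite cmod_cexp -[ltRHS](expln _ r0) ltr_expR.
  have d1 := cdiff_comp (cdiff_cexp z) (df _ Ez).
  have d2 : cdiff (fun z => cexp (- z)) z (cexp (- z) * (-1)).
    have h := @cdiff_affine R z 0 (-1).
    have /= h2 := cdiff_comp h (cdiff_cexp _).
    by apply: (cdiff_eq h2) => [y|]; rewrite add0r mulN1r.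
  eexists; apply: cdiffM d2.
  exact: cdiffB d1 (cdiff_cst z (f 0)).
- move=> z; rewrite /F.
  have E w : cexp (w + mkC 0 (pi *+ 2)) = cexp w.
    by apply: Cext; rewrite /cexp !CE /= addr0 ?cosD2pi ?sinD2pi.
  by rewrite E; congr (_ * _); rewrite -[LHS]E opprD subrK.
- by rewrite ltr_ln.
- by rewrite ltr_ln//; lra.
- move=> y; rewrite -CReN -CReD; apply: (le_trans (CRe_le _)).
  set z := mkC _ _; have Ez : cmod (cexp z) = s by rewrite cmod_cexp /= expln.
  have -> : F z - f' 0 = (f (0 + cexp z) - f 0 - f' 0 * cexp z) * cexp (- z).
    by rewrite add0r [RHS]mulrBl -[_ * _ * _]mulrA cexpN mulr1.
  have Ey : cmod (cexp (- z)) = s^-1 by rewrite cmod_cexp CReN /= expRN expln.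
  rewrite cmodM Ey ler_pdivrMr// -Ez; apply: hd.
  by rewrite Ez.
- move=> y; rewrite subr0; apply: (le_trans (CRe_le _)).
  set z := mkC _ _; have Ez : cmod (cexp z) = r / 2 by rewrite cmod_cexp /= expln.
  have Ey : cmod (cexp (- z)) = (r / 2)^-1 by rewrite cmod_cexp CReN /= expRN expln.
  rewrite cmodM Ey ler_pdivrMr//.
  have -> : 4 * M / r * (r / 2) = M + M by field; rewrite gt_eqF.
  apply: (le_trans (cmodD _ _)); rewrite cmodN lerD ?fM// Ez; lra.
Qed.

(** The estimate for real parts, applied to [f] and to [i f], controls both components of the
    derivative; this doubles the constant to [8]. *)
Lemma cauchy_estimate f f' z (r M : R) : 0 < r ->
  (forall w, cmod (w - z) < r -> cdiff f w (f' w)) ->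
  (forall w, cmod (w - z) < r -> cmod (f w) <= M) -> cmod (f' z) <= 8 * M / r.
Proof.
move=> r0 df fM.
have df0 w : cmod w < r -> cdiff (fun w => f (z + w)) w (f' (z + w)).
  move=> wr; have := df (z + w); rewrite addrC addKr => /(_ wr) h.
  have k := @cdiff_affine R w z 1.
  have := cdiff_comp k; rewrite mul1r => /(_ _ _ h) {}k.
  by apply: (cdiff_eq k) => [y|]; rewrite ?mul1r ?mulr1.
have fM0 w : cmod w < r -> cmod (f (z + w)) <= M.
  by move=> wr; apply: fM; rewrite addrC addKr.
have h1 := cauchy_estimate_Re r0 df0 fM0.
have df1 w : cmod w < r -> cdiff (fun w => mkC 0 1 * f (z + w)) w (mkC 0 1 * f' (z + w)).
  by move=> wr; apply: cdiffZ; exact: df0.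
have fM1 w : cmod w < r -> cmod (mkC 0 1 * f (z + w)) <= M.
  by move=> wr; rewrite cmodM cmod_imag normr1 mul1r fM0.
have := cauchy_estimate_Re r0 df1 fM1.
rewrite CReM /= mul0r mul1r sub0r normrN; rewrite addr0 in h1 *.
have := cmod_le (f' z).
have -> : 8 * M / r = 4 * M / r + 4 * M / r by rewrite -mulrDl; congr (_ / _); ring.
lra.
Qed.

End CauchyEstimate.

(** * Bounded holomorphic functions of one and two variables *)

Section TwoVariables.
Context {R : realType}.
Local Notation C := (Cplx R).
Implicit Types (f g : C -> C) (z w c h u v : C).

Lemma cdiff_shift f z a k : cdiff f (a + z) k -> cdiff (fun w => f (a + w)) z k.
Proof.
move=> H; have d := @cdiff_affine R z a 1.
have := cdiff_comp d; rewrite mul1r => /(_ _ _ H) {}d.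
by apply: (cdiff_eq d) => [y|]; rewrite ?mul1r ?mulr1.
Qed.

Lemma cdiff_line f u v (t : R) k : cdiff f (v + mkC t 0 * u) k ->
  is_derive t 1 (fun t : R => CRe (f (v + mkC t 0 * u))) (CRe (k * u)) /\
  is_derive t 1 (fun t : R => CIm (f (v + mkC t 0 * u))) (CIm (k * u)).
Proof.
move=> H; have d := @cdiff_affine R (mkC t 0) v u.
have := cdiff_comp d; rewrite [u * _]mulrC => /(_ _ _ H) {}d.
have [/linapprox_derive[di _] /linapprox_derive[dr _]] := cdiff_linapprox d.
split.
- by move: dr; under eq_fun do rewrite [u * _]mulrC.
- by move: di; under eq_fun do rewrite [u * _]mulrC.
Qed.

(** The real mean value theorem is applied to each component along the segment, whence the factor
    [2]. *)
Lemma mean_value_ineq f f' u v c (K : R) :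
  (forall t : R, 0 <= t <= 1 -> let w := v + mkC t 0 * (u - v) in
    cdiff f w (f' w) /\ cmod (f' w - c) <= K) ->
  cmod (f u - f v - c * (u - v)) <= 2 * K * cmod (u - v).
Proof.
move=> H; have E1 : v + mkC 1 0 * (u - v) = u by rewrite [_ * _]mul1r addrC subrK.
have E0 : v + mkC 0 0 * (u - v) = v by rewrite [_ * _]mul0r addr0.
have B (t : R) : 0 <= t <= 1 ->
    cmod ((f' (v + mkC t 0 * (u - v)) - c) * (u - v)) <= K * cmod (u - v).
  by move=> /H[_ h]; rewrite cmodM ler_wpM2r// cmod_ge0.
have := @mean_value_bound R (fun t : R => CRe (f (v + mkC t 0 * (u - v))))
  (fun t => CRe (f' (v + mkC t 0 * (u - v)) * (u - v))) 0 1
  (CRe (c * (u - v))) (K * cmod (u - v)) ler01.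
rewrite E1 E0 subr0 !mulr1 => hr.
have := @mean_value_bound R (fun t : R => CIm (f (v + mkC t 0 * (u - v))))
  (fun t => CIm (f' (v + mkC t 0 * (u - v)) * (u - v))) 0 1
  (CIm (c * (u - v))) (K * cmod (u - v)) ler01.
rewrite E1 E0 subr0 !mulr1 => hi.
apply: (le_trans (cmod_le _)).
have -> : 2 * K * cmod (u - v) = K * cmod (u - v) + K * cmod (u - v) by ring.
apply: lerD.
- rewrite !(CReD _ (- _)) !CReN; apply: hr => t t01.
    by case: (H t t01) => /cdiff_line[].
  by rewrite -CReN -CReD -mulNr -mulrDl; apply: le_trans (CRe_le _) (B t t01).
- rewrite !(CImD _ (- _)) !CImN; apply: hi => t t01.
    by case: (H t t01) => /cdiff_line[].
  by rewrite -CImN -CImD -mulNr -mulrDl; apply: le_trans (CIm_le _) (B t t01).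
Qed.

Lemma cmod_segment u v z (t r : R) : 0 <= t <= 1 ->
  cmod (u - z) < r -> cmod (v - z) < r -> cmod (v + mkC t 0 * (u - v) - z) < r.
Proof.
move=> t01 hu hv.
have -> : v + mkC t 0 * (u - v) - z = mkC t 0 * (u - z) + mkC (1 - t) 0 * (v - z).
  by apply: Cext; rewrite !CE /=; ring.
apply: (le_lt_trans (cmodD _ _)); rewrite !cmodM !cmod_real !ger0_norm; [|lra..].
have [->|t0] := eqVneq t 0; first by rewrite mul0r subr0 mul1r add0r.
have tp : 0 < t by rewrite lt_neqAle eq_sym t0; case/andP: t01.
have : t * cmod (u - z) < t * r by rewrite ltr_pM2l.
have : (1 - t) * cmod (v - z) <= (1 - t) * r by apply: ler_wpM2l; [lra|exact: ltW].
lra.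
Qed.

(** Cauchy's estimate on discs of radius [r] centred on the segment bounds the derivative by
    [8 * M / r]. *)
Lemma holo_lip f f' z (r M : R) : 0 < r ->
  (forall w, cmod (w - z) < 2 * r -> cdiff f w (f' w)) ->
  (forall w, cmod (w - z) < 2 * r -> cmod (f w) <= M) ->
  forall u v, cmod (u - z) < r -> cmod (v - z) < r ->
  cmod (f u - f v) <= 16 * M / r * cmod (u - v).
Proof.
move=> r0 df fM u v hu hv.
have := @mean_value_ineq f f' u v 0 (8 * M / r); rewrite mul0r subr0.
have -> : 2 * (8 * M / r) = 16 * M / r by rewrite !mulrA; congr (_ * _ / _); ring.
apply=> t t01 /=; have := cmod_segment t01 hu hv; move: (v + _) => w wr.
rewrite subr0; split; first by apply: df; lra.
have T x : cmod (x - w) < r -> cmod (x - z) < 2 * r.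
  by move=> xr; have := cmodD (x - w) (w - z); rewrite addrA subrK; lra.
by apply: cauchy_estimate => // x /T; auto.
Qed.

(** Cauchy's estimate for the increment [f (k + w) - f w], which is of order [cmod k] by [holo_lip],
    shows that [f'] is Lipschitz at [z] before anything is known about its differentiability. The
    mean value inequality then turns [64] into [128]. *)
Lemma holo_taylor f f' z (r M : R) : 0 < r ->
  (forall w, cmod (w - z) < 4 * r -> cdiff f w (f' w)) ->
  (forall w, cmod (w - z) < 4 * r -> cmod (f w) <= M) ->
  forall h, cmod h < r ->
  cmod (f (z + h) - f z - f' z * h) <= 128 * M / r ^+ 2 * cmod h ^+ 2.
Proof.
move=> r0 df fM h hr.
have r4 : 4 * r = 2 * (2 * r) by ring.
have Lip k : cmod k < r -> cmod (f' (z + k) - f' z) <= 64 * M / r ^+ 2 * cmod k.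
  move=> kr; have -> : 64 * M / r ^+ 2 * cmod k = 8 * (8 * M / r * cmod k) / r.
    by field; rewrite gt_eqF.
  rewrite [z + k]addrC.
  apply: (@cauchy_estimate R (fun w => f (k + w) - f w) (fun w => f' (k + w) - f' w) z r
    (8 * M / r * cmod k) r0).
    move=> w wr; apply: cdiffB; last by apply: df; lra.
    apply: cdiff_shift; apply: df; have := cmodD k (w - z); rewrite addrA; lra.
  move=> w wr.
  have -> : 8 * M / r = 16 * M / (2 * r) by field; rewrite gt_eqF.
  rewrite -[in cmod k](addrK w k).
  apply: (@holo_lip f f' z (2 * r) M); rewrite ?mulr_gt0//.
  - by move=> x; rewrite -r4; exact: df.
  - by move=> x; rewrite -r4; exact: fM.
  - by have := cmodD k (w - z); rewrite addrA; lra.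
  - by lra.
have := @mean_value_ineq f f' (z + h) z (f' z) (64 * M / r ^+ 2 * cmod h).
rewrite [z + h - z]addrC addKr.
have -> : 2 * (64 * M / r ^+ 2 * cmod h) * cmod h =
  128 * M / r ^+ 2 * cmod h ^+ 2 by ring.
apply=> t t01 /=.
have th : cmod (mkC t 0 * h) <= cmod h.
  by rewrite cmodM cmod_real ger0_norm; [rewrite ler_piMl ?cmod_ge0//|]; lra.
have c0 := cmod_ge0 h.
split; first by apply: df; rewrite addrC addKr; lra.
have M0 : 0 <= M by apply: le_trans (cmod_ge0 _) (fM z _); rewrite subrr cmod0; lra.
apply: (le_trans (Lip _ _)); first lra.
by apply: ler_wpM2l => //; rewrite divr_ge0 ?sqr_ge0// mulr_ge0.
Qed.

(** The limit at [0] is the supremum of the lower bounds [q h - K * cmod h], since each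
    [q k + K * cmod k] lies above all of them. This form gives the rate of convergence as well. *)
Lemma difference_quotient_limit (q : C -> R) (K r : R) : 0 < r ->
  (forall h k, h != 0 -> k != 0 -> cmod h < r -> cmod k < r ->
    `|q h - q k| <= K * (cmod h + cmod k)) ->
  exists T, forall h, h != 0 -> cmod h < r -> `|q h - T| <= K * cmod h.
Proof.
move=> r0 H; pose S := [set x | exists h, [/\ h != 0, cmod h < r & x = q h - K * cmod h]].
have ub h : h != 0 -> cmod h < r -> ubound S (q h + K * cmod h).
  move=> h0 hr _ [k [k0 kr ->]]; have := H k h k0 h0 kr hr.
  by rewrite ler_norml; lra.
exists (sup S) => h h0 hr; rewrite ler_norml; apply/andP; split.
  suff : sup S <= q h + K * cmod h by lra.
  by apply: ge_sup; [exists (q h - K * cmod h), h | exact: ub].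
suff : q h - K * cmod h <= sup S by lra.
by apply: ub_le_sup; [exists (q h + K * cmod h); exact: ub | exists h].
Qed.

(** Only separate differentiability on a bidisc, with a bound; joint differentiability and
    differentiability of [Fa] and [Fb] are derived from it. *)
Definition holo2 (F Fa Fb : C -> C -> C) (r M : R) :=
  forall a b, cmod a < r -> cmod b < r ->
  [/\ cdiff (F^~ b) a (Fa a b), cdiff (F a) b (Fb a b) & cmod (F a b) <= M].

Lemma holo2_taylor F Fa Fb (r M : R) : 0 < r -> holo2 F Fa Fb (4 * r) M ->
  forall a h, cmod a < 4 * r -> cmod h < r ->
  cmod (F a h - F a 0 - Fb a 0 * h) <= 128 * M / r ^+ 2 * cmod h ^+ 2.
Proof.
move=> r0 H a h ar hr.
rewrite -[h in F a h]add0r; apply: (@holo_taylor (F a) (Fb a) 0 r M r0) => // w;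
  rewrite subr0 => wr.
  by case: (H a w ar wr).
by case: (H a w ar wr).
Qed.

(* The quotients [(F a h - F a 0) / h] are uniformly Cauchy in [a] as [h] tends
   to [0], and Cauchy's estimate passes this on to their derivatives in [a]. *)
Lemma holo2_mixed F Fa Fb (r M : R) : 0 < r -> holo2 F Fa Fb (4 * r) M ->
  exists T, cdiff (Fa 0) 0 T.
Proof.
move=> r0 H; have r4 : r < 4 * r by lra.
have tl := holo2_taylor r0 H.
have z4 : cmod (0 : C) < 4 * r by rewrite cmod0; lra.
have M0 : 0 <= M by case: (H 0 0 z4 z4) => _ _; apply: le_trans (cmod_ge0 _).
pose q h := h^-1 * (Fa 0 h - Fa 0 0).
have qC h k : h != 0 -> k != 0 -> cmod h < r -> cmod k < r ->
    cmod (q h - q k) <= 1024 * M / r ^+ 3 * (cmod h + cmod k).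
  move=> h0 k0 hr kr.
  (* The Taylor constant is the same for all [a], so two quotients differ by a small amount on a
     whole disc; Cauchy's estimate multiplies it by [8 / r]. *)
  have Q x (x0 : x != 0) (xr : cmod x < r) a (ar : cmod a < 4 * r) :
      cmod ((F a x - F a 0) / x - Fb a 0) <= 128 * M / r ^+ 2 * cmod x.
    have -> : (F a x - F a 0) / x - Fb a 0 = (F a x - F a 0 - Fb a 0 * x) / x by field.
    rewrite cmodM cmodV ler_pdivrMr ?cmod_gt0//; apply: (le_trans (tl _ _ ar xr)).
    by rewrite expr2 mulrA.
  have -> : 1024 * M / r ^+ 3 * (cmod h + cmod k) =
    8 * (128 * M / r ^+ 2 * (cmod h + cmod k)) / r by field; rewrite gt_eqF.
  apply: (@cauchy_estimate R
    (fun a => h^-1 * (F a h - F a 0) - k^-1 * (F a k - F a 0))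
    (fun a => h^-1 * (Fa a h - Fa a 0) - k^-1 * (Fa a k - Fa a 0)) 0) => // a;
    rewrite subr0 => ar.
  - have ar4 := lt_trans ar r4.
    have d x : cmod x < 4 * r -> cdiff (F^~ x) a (Fa a x) by move=> xr; case: (H a x ar4 xr).
    by apply: cdiffB; apply: cdiffZ; apply: cdiffB; apply: d => //; lra.
  - have ar4 := lt_trans ar r4.
    have -> : h^-1 * (F a h - F a 0) - k^-1 * (F a k - F a 0) =
      ((F a h - F a 0) / h - Fb a 0) - ((F a k - F a 0) / k - Fb a 0) by ring.
    apply: (le_trans (cmodD _ _)); rewrite cmodN mulrDr.
    by apply: lerD; exact: Q.
have [|Tr hTr] := @difference_quotient_limit (fun h => CRe (q h)) (1024 * M / r ^+ 3) r r0.
  move=> h k h0 k0 hr kr; rewrite -CReN -CReD.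
  exact: le_trans (CRe_le _) (qC _ _ h0 k0 hr kr).
have [|Ti hTi] := @difference_quotient_limit (fun h => CIm (q h)) (1024 * M / r ^+ 3) r r0.
  move=> h k h0 k0 hr kr; rewrite -CImN -CImD.
  exact: le_trans (CIm_le _) (qC _ _ h0 k0 hr kr).
exists (mkC Tr Ti) => e e0.
(* The factor [2] collects the real and imaginary parts; the added [1] makes [K] positive even when
   [M] is [0]. *)
pose K := 2 * (1024 * M / r ^+ 3) + 1.
have K0 : 0 < K by rewrite ltr_wpDl// mulr_ge0// divr_ge0 ?exprn_ge0 ?mulr_ge0//; lra.
exists (Num.min r (e / K)); first by rewrite lt_min r0 divr_gt0.
move=> h; rewrite lt_min ltr_pdivlMr// => /andP[hr hK]; rewrite add0r.
have [->|h0] := eqVneq h 0; first by rewrite subrr mulr0 subrr cmod0 mulr0.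
have -> : Fa 0 h - Fa 0 0 - mkC Tr Ti * h = (q h - mkC Tr Ti) * h.
  by rewrite /q; field.
rewrite cmodM ler_pM2r ?cmod_gt0//; apply: (le_trans (cmod_le _)).
rewrite CReD CImD CReN CImN /=.
have := hTr h h0 hr; have := hTi h h0 hr; have := cmod_ge0 h.
rewrite /K in hK; lra.
Qed.

(** Move first in [b], then in [a]: besides two Taylor remainders in one variable there is the term
    [(Fa 0 b - Fa 0 0) * a]. It is controlled by Cauchy's estimate in the first variable for
    [F a b - F a 0], which is of order [cmod b]. *)
Lemma holo2_frechet F Fa Fb (r M : R) : 0 < r -> holo2 F Fa Fb (4 * r) M ->
  forall a b, cmod a < r -> cmod b < r ->
  cmod (F a b - F 0 0 - Fa 0 0 * a - Fb 0 0 * b) <=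
    128 * M / r ^+ 2 * (cmod a + cmod b) ^+ 2.
Proof.
move=> r0 H a b ar br; have r4 : r < 4 * r by lra.
have z4 : cmod (0 : C) < 4 * r by rewrite cmod0; lra.
have M0 : 0 <= M by case: (H 0 0 z4 z4) => _ _; apply: le_trans (cmod_ge0 _).
have H' : holo2 (fun a b => F b a) (fun a b => Fb b a) (fun a b => Fa b a) (4 * r) M.
  by move=> x y xr yr; case: (H y x yr xr).
have T1 := holo2_taylor r0 H' (lt_trans br r4) ar.
have T2 := holo2_taylor r0 H z4 br.
have T3 : cmod (Fa 0 b - Fa 0 0) <= 64 * M / r ^+ 2 * cmod b.
  have -> : 64 * M / r ^+ 2 * cmod b = 8 * (16 * M / (2 * r) * cmod b) / r.
    by field; rewrite gt_eqF.
  apply: (@cauchy_estimate R (fun a => F a b - F a 0) (fun a => Fa a b - Fa a 0) 0) => // w;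
    rewrite subr0 => wr; have wr4 := lt_trans wr r4.
  - by apply: cdiffB; [case: (H w b wr4) => //; lra|case: (H w 0 wr4)].
  - rewrite -[in cmod b](subr0 b); have r22 : 4 * r = 2 * (2 * r) by ring.
    apply: (@holo_lip (F w) (Fb w) 0); rewrite ?subr0 ?cmod0; try lra;
      by move=> x; rewrite subr0 -r22 => xr; case: (H w x wr4 xr).
have -> : F a b - F 0 0 - Fa 0 0 * a - Fb 0 0 * b =
  (F a b - F 0 b - Fa 0 b * a) + (Fa 0 b - Fa 0 0) * a + (F 0 b - F 0 0 - Fb 0 0 * b).
  by ring.
apply: (le_trans (cmodD _ _)).
have := cmodD (F a b - F 0 b - Fa 0 b * a) ((Fa 0 b - Fa 0 0) * a).
rewrite cmodM; have := ler_wpM2r (cmod_ge0 a) T3.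
move: T1 T2; have -> : 64 * M / r ^+ 2 = (128 * M / r ^+ 2) / 2.
  by field; rewrite gt_eqF.
have : 0 <= 128 * M / r ^+ 2 by rewrite divr_ge0 ?sqr_ge0// mulr_ge0.
move: (128 * M / r ^+ 2) => K K0.
have := mulr_ge0 K0 (mulr_ge0 (cmod_ge0 a) (cmod_ge0 b)).
lra.
Qed.

Definition cfrechet2 (F : C -> C -> C) T1 T2 := forall e : R, 0 < e ->
  exists2 d : R, 0 < d & forall a b, cmod a < d -> cmod b < d ->
  cmod (F a b - F 0 0 - T1 * a - T2 * b) <= e * (cmod a + cmod b).

Lemma holo2_cfrechet F Fa Fb (r M : R) : 0 < r -> holo2 F Fa Fb r M ->
  cfrechet2 F (Fa 0 0) (Fb 0 0).
Proof.
move=> r0 H e e0.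
have [t t0 rt] : exists2 t : R, 0 < t & r = 4 * t 
  by exists (r / 4); [rewrite divr_gt0|field].
rewrite rt in H; have h := holo2_frechet t0 H.
pose K := `|128 * M / t ^+ 2| + 1.
have K0 : 0 < K by rewrite ltr_wpDl.
exists (Num.min t (e / 2 / K)); first by rewrite lt_min t0 !divr_gt0.
move=> a b; rewrite !lt_min !ltr_pdivlMr// => /andP[a1 a2] /andP[b1 b2].
apply: (le_trans (h a b a1 b1)).
have c0 : 0 <= cmod a + cmod b by rewrite addr_ge0 ?cmod_ge0.
rewrite expr2 mulrA ler_wpM2r//.
apply: (@le_trans _ _ (K * (cmod a + cmod b))); last by lra.
by rewrite ler_wpM2r// (le_trans (ler_norm _))// lerDl.
Qed.

Lemma holo2_shift F Fa Fb (r r' M : R) a b : cmod a + r' <= r -> cmod b + r' <= r ->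
  holo2 F Fa Fb r M ->
  holo2 (fun x y => F (a + x) (b + y)) (fun x y => Fa (a + x) (b + y))
    (fun x y => Fb (a + x) (b + y)) r' M.
Proof.
move=> ar br H x y xr yr; have := cmodD a x; have := cmodD b y => by_ ax.
have [||h1 h2 h3] := H (a + x) (b + y); [lra..|].
by split=> //; [exact: (@cdiff_shift (F^~ (b + y))) | exact: (@cdiff_shift (F (a + x)))].
Qed.

(* Differentiability of [Fa] in its first variable is the mixed case for the
   function [(x, y) |-> F (a + x + y) b]. *)
Lemma holo2_derivative F Fa Fb (r M : R) : 0 < r -> holo2 F Fa Fb r M ->
  exists2 s : R, 0 < s & exists Faa Fab N, holo2 Fa Faa Fab s N.
Proof.
move=> r0 H; pose s := r / 4.
have s0 : 0 < s by rewrite divr_gt0.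
have rs : r = 4 * s by rewrite /s; lra.
exists s => //.
suff : forall p : C * C, exists q : C * C, cmod p.1 < s -> cmod p.2 < s ->
    cdiff (Fa^~ p.2) p.1 q.1 /\ cdiff (Fa p.1) p.2 q.2.
  move=> /choice[q Q].
  (* The bound on [Fa] is Cauchy's estimate on the disc of radius [s] around [a], contained in the
     disc of radius [2 * s] around [0]. *)
  exists (fun a b => (q (a, b)).1), (fun a b => (q (a, b)).2), (8 * M / s).
  move=> a b ar br; have [h1 h2] := Q (a, b) ar br; split=> //.
  apply: (@cauchy_estimate R (F^~ b) (Fa^~ b)) => // w wa;
    by have := cmodD (w - a) a; rewrite subrK => wc; case: (H w b) => //; lra.
move=> [a b] /=; have [as_|?] := ltP (cmod a) s; last by exists (0, 0) => ?; lra.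
have [bs|?] := ltP (cmod b) s; last by exists (0, 0) => ? ?; lra.
have s40 : 0 < s / 4 by rewrite divr_gt0.
have s4 : 4 * (s / 4) = s by field.
have [|T1 h1] := @holo2_mixed (fun x y => F (a + x + y) b)
    (fun x y => Fa (a + x + y) b)
    (fun x y => Fa (a + x + y) b) (s / 4) M s40.
  rewrite s4 => x y xs ys.
  have := cmodD a x; have := cmodD (a + x) y => c1 c2.
  have [||k1 _ k3] := H (a + x + y) b; [lra..|]; split => //.
  - have := @cdiff_shift (F^~ b) x (a + y) _; rewrite addrAC => /(_ _ k1) h.
    by apply: (cdiff_ext _ h) => z; rewrite addrAC.
  - exact: (@cdiff_shift (F^~ b)).
have [|T2 h2] := @holo2_mixed (fun x y => F (a + x) (b + y))
    (fun x y => Fa (a + x) (b + y))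
    (fun x y => Fb (a + x) (b + y)) (s / 4) M s40.
  by rewrite s4; apply: holo2_shift H; lra.
exists (T1, T2) => _ _ /=; split.
- have := @cdiff_shift (fun w => Fa (a + 0 + w) b) a (- a) T1.
  rewrite addNr => /(_ h1) k; apply: (cdiff_ext _ k) => z.
  by rewrite addr0 addrA subrr add0r.
- have := @cdiff_shift (fun w => Fa (a + 0) (b + w)) b (- b) T2.
  rewrite addNr => /(_ h2) k; apply: (cdiff_ext _ k) => z.
  by rewrite addr0 addrA subrr add0r.
Qed.

Lemma holo2_derivative_cfrechet F Fa Fb (r M : R) : 0 < r -> holo2 F Fa Fb r M ->
  exists T1 T2, cfrechet2 Fa T1 T2.
Proof.
move=> r0 H; have [s s0 [Faa [Fab [N HN]]]] := holo2_derivative r0 H.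
by exists (Faa 0 0), (Fab 0 0); exact: holo2_cfrechet HN.
Qed.

Lemma holo2_swap F Fa Fb (r M : R) : holo2 F Fa Fb r M ->
  holo2 (fun a b => F b a) (fun a b => Fb b a) (fun a b => Fa b a) r M.
Proof. by move=> H x y xr yr; case: (H y x yr xr). Qed.

Lemma cfrechet2_swap F T1 T2 : cfrechet2 (fun a b => F b a) T1 T2 -> cfrechet2 F T2 T1.
Proof.
move=> H e e0; have [d d0 h] := H e e0; exists d => // a b ad bd.
by rewrite [cmod a + _]addrC addrAC; exact: h.
Qed.

(** Chain rule for the curves onto which [piU] bends straight lines: the term [b * h ^+ 2] comes
    from the squared norm in the [w]-component and leaves the derivative at [0] unchanged. *)
Lemma cdiff_curve F T1 T2 a b c : cfrechet2 F T1 T2 ->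
  cdiff (fun h => F (a * h + b * h ^+ 2) (c * h)) 0 (T1 * a + T2 * c).
Proof.
move=> H e e0; pose A := cmod a + cmod b + cmod c + 1; pose B := cmod T1 * cmod b + 1.
have A0 : 0 < A by rewrite ltr_wpDl// !addr_ge0 ?cmod_ge0.
have B0 : 0 < B by rewrite ltr_wpDl// mulr_ge0 ?cmod_ge0.
have [|d d0 h] := H (e / 4 / A); first by rewrite !divr_gt0.
exists (Num.min (Num.min 1 (d / A)) (e / 2 / B)); first by rewrite !lt_min ltr01 !divr_gt0.
move=> k; rewrite !lt_min !ltr_pdivlMr// => /andP[/andP[k1 kd] kB].
rewrite add0r !mulr0 expr0n mulr0 addr0.
have k0 := cmod_ge0 k; have a0 := cmod_ge0 a.
have b0 := cmod_ge0 b; have c0 := cmod_ge0 c.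
have s1 : cmod (a * k + b * k ^+ 2) <= A * cmod k.
  apply: (le_trans (cmodD _ _)); rewrite !cmodM.
  have : cmod b * (cmod k * cmod k) <= cmod b * cmod k.
    by apply: ler_wpM2l => //; rewrite ler_piMl// ltW.
  have := mulr_ge0 c0 k0; rewrite /A; lra.
have s2 : cmod (c * k) <= A * cmod k.
  by rewrite cmodM ler_wpM2r// /A; lra.
have := h (a * k + b * k ^+ 2) (c * k).
move=> /(_ (le_lt_trans s1 _) (le_lt_trans s2 _)).
rewrite ![A * _]mulrC => /(_ kd kd) h1.
have -> : F (a * k + b * k ^+ 2) (c * k) - F 0 0 - (T1 * a + T2 * c) * k =
 F (a * k + b * k ^+ 2) (c * k) - F 0 0 - T1 * (a * k + b * k ^+ 2) - T2 * (c * k) +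
 (T1 * b) * (k * k) by ring.
apply: (le_trans (cmodD _ _)); rewrite !cmodM.
have h2 : e / 4 / A * (cmod (a * k + b * k ^+ 2) + cmod (c * k)) <= e / 2 * cmod k.
  apply: (@le_trans _ _ (e / 4 / A * (2 * (A * cmod k)))).
    by rewrite ler_pM2l ?divr_gt0//; lra.
  by rewrite le_eqVlt; apply/orP; left; apply/eqP; field; rewrite gt_eqF.
have h3 : cmod T1 * cmod b * (cmod k * cmod k) <= e / 2 * cmod k.
  rewrite mulrA ler_wpM2r//; apply: (@le_trans _ _ (cmod k * B)); last lra.
  rewrite mulrC ler_wpM2l//.
  by rewrite /B lerDl.
lra.
Qed.

End TwoVariables.

(** * Restriction of a holomorphic function to complex planes *)

Section Planes.
Context {R : realType}.
Local Notation C := (Cplx R).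
Variable V : normedModType C.
Implicit Types (F : V -> C) (q u v : V).

Lemma ltcC (z : C) (d : C) : 0 < d -> (`|z| < d) = (cmod z < CRe d).
Proof. by rewrite cmodE !ltcE /= => /andP[/eqP -> _]; rewrite eqxx. Qed.

Lemma lecC (z w : C) (e : R) : (`|z| <= mkC e 0 * `|w|) = (cmod z <= e * cmod w).
Proof. by rewrite !cmodE lecE /= !(mul0r, mulr0, addr0, subr0) eqxx. Qed.

Lemma CRe_gt0 (d : C) : 0 < d -> 0 < CRe d.
Proof. by rewrite ltcE => /andP[]. Qed.

Lemma differentiable_cdiff F q u : differentiable F q ->
  cdiff (fun a => F (q + a *: u)) 0 ('D_u F q).
Proof.
move=> dF e e0; have ec0 : (0 : C) < mkC e 0 by rewrite ltcE /= eqxx.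
have H : h^-1 *: (F (h *: u + q) - F q) @[h --> (0 : C)^'] --> 'D_u F q.
  exact: (diff_derivable dF).
move: H => /cvgrPdist_le /(_ _ ec0) /nbhs_ballP[d /= d0 H].
exists (CRe d); first exact: CRe_gt0.
move=> h hd; rewrite add0r scale0r addr0.
have [->|h0] := eqVneq h 0; first by rewrite scale0r addr0 subrr mulr0 subrr cmod0 mulr0.
have := H h; rewrite /ball /= sub0r normrN ltcC// => /(_ hd h0).
rewrite -(ler_pM2r (_ : 0 < `|h|)) ?normr_gt0// -normrM mulrBl distrC.
by rewrite [h^-1 *: _]mulrC mulfVK// [_ + q]addrC lecC.
Qed.

(** The bound required by [holo2] comes from continuity at [q]: on a small bidisc [F] stays within
    [1] of [F q]. The number [N] exceeds the sum of the norms of [u] and [v], so coefficients below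
    [CRe d / N] stay in the ball of radius [d]. *)
Lemma plane_holo2 F q u v (r0 : R) : 0 < r0 ->
  (forall a b : C, cmod a < r0 -> cmod b < r0 -> differentiable F (q + a *: u + b *: v)) ->
  exists r M : R, [/\ 0 < r, r <= r0 &
    holo2 (fun a b => F (q + a *: u + b *: v))
      (fun a b => 'D_u F (q + a *: u + b *: v))
      (fun a b => 'D_v F (q + a *: u + b *: v)) r M].
Proof.
move=> r00 dF.
have z0 : cmod (0 : C) < r0 by rewrite cmod0.
have := dF 0 0 z0 z0; rewrite !scale0r !addr0 => /differentiable_continuous.
move=> /cvgrPdist_lt /(_ 1 ltr01) /nbhs_ballP[d /= d0 Hd].
pose N := CRe `|u| + CRe `|v| + 1.
have Ru (w : V) : `|w| = mkC (CRe `|w|) 0 :> C.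
  by have := normr_ge0 w; rewrite lecE /= => /andP[/eqP]; case: (`|w|) => x y /= -> _.
have Rp (w : V) : 0 <= CRe `|w| by have := normr_ge0 w; rewrite lecE => /andP[].
have N0 : 0 < N by rewrite ltr_wpDl// addr_ge0.
exists (Num.min r0 (CRe d / N)), (cmod (F q) + 1); split.
- by rewrite lt_min r00 divr_gt0// CRe_gt0.
- by rewrite ge_min lexx.
move=> a b; rewrite !lt_min => /andP[ar adN] /andP[br bdN].
have D := dF a b ar br.
split.
- have h := differentiable_cdiff u D.
  have := @cdiff_shift R (fun x => F (q + a *: u + b *: v + x *: u)) a (- a) _.
  rewrite addNr => /(_ _ h) {}h; apply: (cdiff_ext _ h) => x.
  by congr F; rewrite scalerDl scaleNr [q + _ + _]addrAC -[LHS]addrA addNKr addrAC.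
- have h := differentiable_cdiff v D.
  have := @cdiff_shift R (fun x => F (q + a *: u + b *: v + x *: v)) b (- b) _.
  rewrite addNr => /(_ _ h) {}h; apply: (cdiff_ext _ h) => x.
  by congr F; rewrite scalerDl scaleNr -[LHS]addrA addNKr.
- have : ball q d (q + a *: u + b *: v).
    rewrite -ball_normE /= opprD !addrA opprD addrA subrr add0r -opprD normrN.
    apply: (le_lt_trans (ler_normD _ _)); rewrite !normrZ Ru [`|v|]Ru !cmodE.
    rewrite ltcE /= !(mul0r, mulr0, addr0, subr0).
    have := d0; rewrite ltcE /= => /andP[-> d0'] /=.
    rewrite !ltr_pdivlMr// in adN bdN.
    have h1 := ler_wpM2l (Rp u) (ltW adN); have h2 := ler_wpM2l (Rp v) (ltW bdN).
    by rewrite -(ltr_pM2r N0); move: h1 h2; rewrite /N; lra.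
  move=> /Hd; rewrite ltcC// /= => h.
  rewrite -(subrK (F q) (F _)) (le_trans (cmodD _ _))// addrC lerD2l cmodB.
  exact: ltW.
Qed.
End Planes.

(** * The heat equation *)

Section RealDerivatives.
Context {R : realType} {V : normedModType R}.
Local Notation C := (Cplx R).

Definition is_cderive (f : V -> C) (p v : V) (c : C) :=
  is_derive p v (CRe \o f) (CRe c) /\ is_derive p v (CIm \o f) (CIm c).

Lemma is_cderive_cderivable f p v c : is_cderive f p v c -> cderivable f p v.
Proof. by move=> [? ?]; split; exact: ex_derive. Qed.

Lemma is_cderive_cderive f p v c : is_cderive f p v c -> cderive f p v = c.
Proof. by move=> [? ?]; rewrite /cderive !derive_val mkCK. Qed.

(** A directional derivative is read off from any complex differentiable [g] that agrees with [f]
    along the line at small real parameters. *)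
Lemma cdiff_is_cderive (f : V -> C) p v g c (d : R) : 0 < d ->
  (forall h : R, `|h| < d -> f (p + h *: v) = g (mkC h 0)) ->
  cdiff g 0 c -> is_cderive f p v c.
Proof.
move=> d0 fg dg.
have H (e : R) : 0 < e -> exists2 d' : R, 0 < d' & forall h : R, `|h| < d' ->
    cmod (f (p + h *: v) - f p - c * mkC h 0) <= e * `|h|.
  move=> e0; have [d1 d10 h1] := dg e e0.
  exists (Num.min d d1); first by rewrite lt_min d0.
  move=> h; rewrite lt_min => /andP[hd hd1].
  have := fg 0; rewrite normr0 scale0r addr0 => /(_ d0) ->; rewrite fg//.
  by have := h1 (mkC h 0); rewrite cmod_real add0r; apply.
split; apply: eps_is_derive => e e0; have [d1 d10 h1] := H e e0;
  exists d1 => // h hd; apply: le_trans (h1 h hd).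
- by apply: le_trans (CRe_le _); rewrite !CE /= mulr0 subr0.
- by apply: le_trans (CIm_le _); rewrite !CE /= mulr0 add0r.
Qed.

End RealDerivatives.

Lemma holo2_cfrechet_at (R : realType) (F Fa Fb : Cplx R -> Cplx R -> Cplx R)
    (r M : R) a b :
  holo2 F Fa Fb r M -> cmod a < r -> cmod b < r ->
  cfrechet2 (fun x y => F (a + x) (b + y)) (Fa a b) (Fb a b).
Proof.
move=> H ar br; pose s := Num.min (r - cmod a) (r - cmod b).
have s0 : 0 < s by rewrite lt_min !subr_gt0 ar.
have sa : s <= r - cmod a by rewrite ge_min lexx.
have sb : s <= r - cmod b by rewrite ge_min lexx orbT.
have H' : holo2 (fun x y => F (a + x) (b + y)) (fun x y => Fa (a + x) (b + y))
    (fun x y => Fb (a + x) (b + y)) s M by apply: holo2_shift H; lra.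
by have := holo2_cfrechet s0 H'; rewrite !addr0.
Qed.

(** * Second derivatives in one coordinate plane and their sum *)

Section Model.
Context {R : realType} {V : normedModType R} {n : nat}.
Variables (incl : R * heis R n -> V) (xcoord : V -> 'rV[R]_(n + n)).
Local Notation C := (Cplx R).

Definition plane_incl (j : 'I_n) (t s x y : R) : V :=
  incl (t, (s, x *: delta_mx 0 (lshift n j) + y *: delta_mx 0 (rshift n j))).

(* The increment of the [w]-component of [piU] when [plane_incl j t s x y] is
   added to a point whose [z_j] is [X + i Y]. *)
Definition wcoord (X Y t s x y : R) : C :=
  mkC s (t + 2 * X * x + 2 * Y * y + x ^+ 2 + y ^+ 2).

Definition plane_model (f : V -> C) p j (F : C -> C -> C) :=
  forall t s x y : R, f (p + plane_incl j t s x y) =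
    F (wcoord (xcoord p 0 (lshift n j)) (xcoord p 0 (rshift n j)) t s x y) (mkC x y).

(** The share of one index [j]: with [d_t = i d_s] and each pair of squares equal to [4 i d_s],
    averaging over [j] gives the heat equation. *)
Definition heat_in_plane (f : V -> C) p j :=
  let l := lshift n j in let r := rshift n j in
  [/\ cderivable f p (dir_t incl), cderivable f p (dir_s incl),
      cderive f p (dir_t incl) = mkC 0 1 * cderive f p (dir_s incl),
      Xfield incl xcoord l (Xfield incl xcoord l f) p +
      Xfield incl xcoord r (Xfield incl xcoord r f) p =
      4 * mkC 0 1 * cderive f p (dir_s incl) &
      forall k, k \in [:: l; r] ->
      [/\ cderivable f p (dir_x incl k),
          cderivable (Xfield incl xcoord k f) p (dir_s incl) &
          cderivable (Xfield incl xcoord k f) p (dir_x incl k)]].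

Hypothesis incl_linear : forall a q q', incl (a *: q + q') = a *: incl q + incl q'.
Hypothesis xcoordD : forall p q, xcoord (p + incl q) = xcoord p + q.2.2.

Lemma plane_incl_linear j (h t s x y dt ds dx dy : R) :
  plane_incl j t s x y + h *: plane_incl j dt ds dx dy =
  plane_incl j (t + h * dt) (s + h * ds) (x + h * dx) (y + h * dy).
Proof.
rewrite addrC /plane_incl -incl_linear; congr incl.
congr (_, (_, _)); rewrite /= [LHS]addrC//.
by rewrite scalerDr !scalerA !scalerDl addrACA.
Qed.

Lemma dir_tE j : dir_t incl = plane_incl j 1 0 0 0.
Proof. by rewrite /plane_incl !scale0r addr0. Qed.
Lemma dir_sE j : dir_s incl = plane_incl j 0 1 0 0.
Proof. by rewrite /plane_incl !scale0r addr0. Qed.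
Lemma dir_xlE j : dir_x incl (lshift n j) = plane_incl j 0 0 1 0.
Proof. by rewrite /plane_incl scale0r addr0 scale1r. Qed.
Lemma dir_xrE j : dir_x incl (rshift n j) = plane_incl j 0 0 0 1.
Proof. by rewrite /plane_incl scale0r add0r scale1r. Qed.

Lemma Xcoef_l j p : Xcoef xcoord (lshift n j) p = 2 * xcoord p 0 (rshift n j).
Proof. by rewrite /Xcoef (unsplitK (inl j)). Qed.
Lemma Xcoef_r j p : Xcoef xcoord (rshift n j) p = - (2 * xcoord p 0 (lshift n j)).
Proof. by rewrite /Xcoef (unsplitK (inr j)). Qed.

Lemma xcoord_plane_l j p t s x y :
  xcoord (p + plane_incl j t s x y) 0 (lshift n j) = xcoord p 0 (lshift n j) + x.
Proof.
by rewrite xcoordD !mxE /= !eqxx (eq_lrshift j j) mulr1 mulr0 addr0.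
Qed.
Lemma xcoord_plane_r j p t s x y :
  xcoord (p + plane_incl j t s x y) 0 (rshift n j) = xcoord p 0 (rshift n j) + y.
Proof.
by rewrite xcoordD !mxE /= !eqxx (eq_rlshift j j) mulr1 mulr0 add0r.
Qed.

Lemma wcoord_small (X Y r : R) : 0 < r -> exists2 d : R, 0 < d &
  forall t s x y : R, `|t| < d -> `|s| < d -> `|x| < d -> `|y| < d ->
  cmod (wcoord X Y t s x y) < r /\ cmod (mkC x y) < r.
Proof.
(* The [4] counts [t], [s] and the two squares, which are at most [d] because the coordinates are
   also below [1]. *)
move=> r0; pose K := 4 + 2 * `|X| + 2 * `|Y|.
have K0 : 0 < K by rewrite /K; have := normr_ge0 X; have := normr_ge0 Y; lra.
exists (Num.min 1 (r / K)); first by rewrite lt_min ltr01 divr_gt0.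
move=> t s x y; rewrite !lt_min => /andP[_ td] /andP[_ sd] /andP[x1 xd] /andP[y1 yd].
set d := r / K in td sd xd yd.
have dK : d * K = r by rewrite divfK// gt_eqF.
have d0 : 0 < d by rewrite divr_gt0.
have hX : `|X| * `|x| <= `|X| * d by rewrite ler_wpM2l// ltW.
have hY : `|Y| * `|y| <= `|Y| * d by rewrite ler_wpM2l// ltW.
have x2 : `|x| * `|x| <= `|x| by rewrite ler_piMl// ltW.
have y2 : `|y| * `|y| <= `|y| by rewrite ler_piMl// ltW.
have := mulr_ge0 (normr_ge0 X) (ltW d0); have := mulr_ge0 (normr_ge0 Y) (ltW d0) => Yd Xd.
split; apply: (le_lt_trans (cmod_le _)); rewrite /= -dK /K; last by lra.
have := ler_normD (t + 2 * X * x + 2 * Y * y + x ^+ 2) (y ^+ 2).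
have := ler_normD (t + 2 * X * x + 2 * Y * y) (x ^+ 2).
have := ler_normD (t + 2 * X * x) (2 * Y * y).
have := ler_normD t (2 * X * x).
rewrite !normrM !normr_nat; lra.
Qed.

Section Point.
Variables (f : V -> C) (p : V) (j : 'I_n) (F Fa Fb : C -> C -> C) (r M d : R).
Hypothesis r0 : 0 < r.
Hypothesis HF : holo2 F Fa Fb r M.
Hypothesis fF : plane_model f p j F.
Local Notation X := (xcoord p 0 (lshift n j)).
Local Notation Y := (xcoord p 0 (rshift n j)).
Local Notation W := (wcoord X Y).
Hypothesis d0 : 0 < d.
Hypothesis Hd : forall t s x y : R, `|t| < d -> `|s| < d -> `|x| < d -> `|y| < d ->
  cmod (W t s x y) < r /\ cmod (mkC x y) < r.

Lemma wcoord_shift (t s x y dt ds dx dy h : R) :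
  W (t + h * dt) (s + h * ds) (x + h * dx) (y + h * dy) =
  W t s x y + (mkC ds (dt + 2 * (X + x) * dx + 2 * (Y + y) * dy) * mkC h 0
     + mkC 0 (dx ^+ 2 + dy ^+ 2) * mkC h 0 ^+ 2).
Proof. by apply: Cext; rewrite /wcoord expr2 !CE /=; ring. Qed.

Lemma mkC_shift (x y dx dy h : R) :
  mkC (x + h * dx) (y + h * dy) = mkC x y + mkC dx dy * mkC h 0.
Proof. by apply: Cext; rewrite !CE /=; ring. Qed.

(** First derivatives are needed at all nearby points of the plane, because they are differentiated
    once more. *)
Lemma model_cderive (t s x y dt ds dx dy : R) :
  `|t| < d -> `|s| < d -> `|x| < d -> `|y| < d ->
  is_cderive f (p + plane_incl j t s x y) (plane_incl j dt ds dx dy)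
   (Fa (W t s x y) (mkC x y) * mkC ds (dt + 2 * (X + x) * dx + 2 * (Y + y) * dy)
    + Fb (W t s x y) (mkC x y) * mkC dx dy).
Proof.
move=> td sd xd yd; have [h1 h2] := Hd td sd xd yd.
apply: cdiff_is_cderive ltr01 _ (cdiff_curve _ _ _ (holo2_cfrechet_at HF h1 h2)) => h _.
by rewrite -addrA plane_incl_linear fF wcoord_shift mkC_shift.
Qed.

(* [X_j f]; then [X_(n+j) f] is [i] times it. *)
Definition Xval t s x y : C :=
  Fb (W t s x y) (mkC x y) + 2 * mkC (Y + y) (X + x) * Fa (W t s x y) (mkC x y).

(** Since [mkC (Y + y) (X + x)] is [i] times the conjugate of the current [z_j], the value is
    [F_z + 2 i (conj z_j) F_w]. *)
Lemma Xfield_l_model t s x y : `|t| < d -> `|s| < d -> `|x| < d -> `|y| < d ->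
  Xfield incl xcoord (lshift n j) f (p + plane_incl j t s x y) = Xval t s x y.
Proof.
move=> td sd xd yd; rewrite /Xfield Xcoef_l xcoord_plane_r.
rewrite dir_xlE (dir_sE j) !(is_cderive_cderive (model_cderive _ _ _ _ td sd xd yd)).
by rewrite /Xval; move: (Fa _ _) (Fb _ _) => u v; apply: Cext; rewrite !CE /=; ring.
Qed.

Lemma Xfield_r_model t s x y : `|t| < d -> `|s| < d -> `|x| < d -> `|y| < d ->
  Xfield incl xcoord (rshift n j) f (p + plane_incl j t s x y) = mkC 0 1 * Xval t s x y.
Proof.
move=> td sd xd yd; rewrite /Xfield Xcoef_r xcoord_plane_l.
rewrite dir_xrE (dir_sE j) !(is_cderive_cderive (model_cderive _ _ _ _ td sd xd yd)).
by rewrite /Xval; move: (Fa _ _) (Fb _ _) => u v; apply: Cext; rewrite !CE /=; ring.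
Qed.

Lemma plane_incl0 : plane_incl j 0 0 0 0 = 0.
Proof.
have := incl_linear (-1) 0 0; rewrite scaler0 addr0 scaleN1r addNr => incl0.
by rewrite /plane_incl !scale0r addr0.
Qed.

(** The conjugate in [Xval] is not complex differentiable, but along a real line it is affine in the
    parameter [h] and so extends to complex [h]. The product rule applies, and the last summand is
    the derivative of that factor. *)
Lemma second_cderive g k (Ta1 Ta2 Tb1 Tb2 : C) (dt ds dx dy : R) :
  cfrechet2 Fa Ta1 Ta2 -> cfrechet2 Fb Tb1 Tb2 ->
  (forall t s x y, `|t| < d -> `|s| < d -> `|x| < d -> `|y| < d ->
     g (p + plane_incl j t s x y) = k * Xval t s x y) ->
  let a := mkC ds (dt + 2 * X * dx + 2 * Y * dy) in let c := mkC dx dy in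
  is_cderive g p (plane_incl j dt ds dx dy)
    (k * ((Tb1 + 2 * mkC Y X * Ta1) * a + (Tb2 + 2 * mkC Y X * Ta2) * c
          + 2 * mkC dy dx * Fa 0 0)).
Proof.
move=> ha hb gk a c.
have -> : (Tb1 + 2 * mkC Y X * Ta1) * a + (Tb2 + 2 * mkC Y X * Ta2) * c
    + 2 * mkC dy dx * Fa 0 0 = Tb1 * a + Tb2 * c
    + (2 * mkC dy dx * Fa 0 0 + 2 * mkC Y X * (Ta1 * a + Ta2 * c)) by ring.
pose b := mkC 0 (dx ^+ 2 + dy ^+ 2).
pose N := `|dt| + `|ds| + `|dx| + `|dy| + 1.
have N0 : 0 < N by rewrite ltr_wpDl// !addr_ge0.
have da := cdiff_curve a b c ha; have db := cdiff_curve a b c hb.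
have dm := @cdiff_affine R 0 (2 * mkC Y X) (2 * mkC dy dx).
have dX := cdiffZ k (cdiffD db (cdiffM dm da)).
rewrite !mulr0 expr0n mulr0 !addr0 in dX.
apply: cdiff_is_cderive (divr_gt0 d0 N0) _ dX => h.
rewrite ltr_pdivlMr// => hd.
have B z : `|z| <= N -> `|h * z| < d.
  by move=> zN; rewrite normrM; apply: le_lt_trans hd; rewrite ler_wpM2l.
have n1 := normr_ge0 dt; have n2 := normr_ge0 ds.
have n3 := normr_ge0 dx; have n4 := normr_ge0 dy.
have := plane_incl_linear j h 0 0 0 0 dt ds dx dy; rewrite plane_incl0 add0r => ->.
rewrite gk; [|by rewrite add0r; apply: B; rewrite /N; lra..].
have := wcoord_shift 0 0 0 0 dt ds dx dy h; rewrite /Xval => ->.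
rewrite mkC_shift !addr0 !add0r -/a -/c -/b.
have -> : W 0 0 0 0 = 0 by apply: Cext; rewrite /= ?mulr0 ?expr0n ?addr0.
rewrite !add0r; congr (_ * (_ + _ * _)).
by apply: Cext; rewrite !CE /=; ring.
Qed.

Lemma plane_heat : heat_in_plane f p j.
Proof.
pose l := lshift n j; pose rr := rshift n j.
have z0 : `|0 : R| < d by rewrite normr0.
have D dt ds dx dy := model_cderive dt ds dx dy z0 z0 z0 z0.
rewrite plane_incl0 addr0 in D.
have W0 : W 0 0 0 0 = 0 by apply: Cext; rewrite /= ?mulr0 ?expr0n ?addr0.
have m0 : mkC 0 0 = 0 :> C by [].
have [Ta1 [Ta2 ha]] := holo2_derivative_cfrechet r0 HF.
have [Tb1 [Tb2 /cfrechet2_swap hb]] := holo2_derivative_cfrechet r0 (holo2_swap HF).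
have El t s x y (td : `|t| < d) (sd : `|s| < d) (xd : `|x| < d) (yd : `|y| < d) :
  Xfield incl xcoord l f (p + plane_incl j t s x y) = 1 * Xval t s x y.
  by rewrite mul1r; exact: Xfield_l_model.
have Dl dt ds dx dy := second_cderive dt ds dx dy ha hb El.
have Dr dt ds dx dy := second_cderive dt ds dx dy ha hb Xfield_r_model.
split.
- by rewrite (dir_tE j); exact: is_cderive_cderivable (D _ _ _ _).
- by rewrite (dir_sE j); exact: is_cderive_cderivable (D _ _ _ _).
- rewrite (dir_tE j) (dir_sE j) !(is_cderive_cderive (D _ _ _ _)).
  by apply: Cext; rewrite !CE /=; ring.
(* Only the two outer fields are unfolded; the derivatives of the inner ones are given by [Dl] and
   [Dr]. *)
- rewrite {1 3}/Xfield /l /rr Xcoef_l Xcoef_r dir_xlE dir_xrE (dir_sE j).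
  rewrite !(is_cderive_cderive (Dl _ _ _ _)) !(is_cderive_cderive (Dr _ _ _ _)).
  rewrite !(is_cderive_cderive (D _ _ _ _)) W0 m0.
  (* [D1] and [D2] are the derivatives of [Xval] with its conjugate factor frozen. The two squares
     contribute them with opposite signs, as [i * i = -1], and each leaves [2 i] times [Fa 0 0]. *)
  move: (Tb1 + _) => D1; move: (Tb2 + _) => D2.
  move: (Fa 0 0) (Fb 0 0) X Y => u v x y.
  by apply: Cext; rewrite !CE /=; ring.
- move=> k; rewrite !inE => /orP[]/eqP->; rewrite /l /rr ?dir_xlE ?dir_xrE (dir_sE j).
  by split; [exact: is_cderive_cderivable (D _ _ _ _)
    |exact: is_cderive_cderivable (Dl _ _ _ _)..].
  by split; [exact: is_cderive_cderivable (D _ _ _ _)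
    |exact: is_cderive_cderivable (Dr _ _ _ _)..].
Qed.

End Point.

(** Positivity of [n] provides an index from which to read the [t] and [s] derivatives, and cancels
    [n] against the [4 n] of the sub-Laplacian. *)
Lemma heat_of_planes (D : set V) (f : V -> C) : (0 < n)%N ->
  (forall p j, D p -> exists F Fa Fb, exists r M : R,
    [/\ 0 < r, holo2 F Fa Fb r M & plane_model f p j F]) ->
  satisfies_heat incl xcoord D f.
Proof.
move=> n0 H p Dp.
have PH j : heat_in_plane f p j.
  have [F [Fa [Fb [r [M [r0 HF fF]]]]]] := H p j Dp.
  have [d d0 Hd] := wcoord_small (xcoord p 0 (lshift n j)) (xcoord p 0 (rshift n j)) r0.
  exact: plane_heat r0 HF fF d0 Hd.
have K (k : 'I_(n + n)) : [/\ cderivable f p (dir_x incl k),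
    cderivable (Xfield incl xcoord k f) p (dir_s incl) &
    cderivable (Xfield incl xcoord k f) p (dir_x incl k)].
  rewrite -(splitK k); case: (fintype.split k) => j;
    by have [_ _ _ _] := PH j; apply; rewrite !inE eqxx ?orbT.
have [ht hs hts _ _] := PH (Ordinal n0).
split; [exact: ht | exact: hs | by move=> k; case: (K k) | by move=> k; case: (K k) |].
rewrite /subLaplacian big_split_ord /= -big_split /=.
rewrite (eq_bigr (fun=> 4 * mkC 0 1 * cderive f p (dir_s incl))); last first.
  by move=> j _; case: (PH j).
rewrite sumr_const card_ord hts -(mulr_natl (4 * _ * _)).
have : n%:R != 0 :> C by rewrite pnatr_eq0 -lt0n.
move: (n%:R : C) => m m0; field.
by rewrite m0.
Qed.

End Model.

(** * Coordinate planes of the product of Siegel domains *)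

Section Siegel.
Context {R : realType}.
Local Notation C := (Cplx R).

Lemma zvecD n (x : 'rV[R]_(n + n)) (j : 'I_n) (a b : R) :
  zvec (x + (a *: delta_mx 0 (lshift n j) + b *: delta_mx 0 (rshift n j))) =
  zvec x + mkC a b *: delta_mx 0 j.
Proof.
apply/rowP => i; rewrite !mxE /= eq_lshift eq_rshift eq_lrshift eq_rlshift.
by apply: Cext; rewrite !CE /=; case: (i == j) => /=; ring.
Qed.

Lemma hnorm2D n (z : 'rV[C]_n) (j : 'I_n) (c : C) :
  hnorm2 (z + c *: delta_mx 0 j) = hnorm2 z +
  (2 * CRe (z 0 j) * CRe c + 2 * CIm (z 0 j) * CIm c + CRe c ^+ 2 + CIm c ^+ 2).
Proof.
rewrite /hnorm2 (bigD1 j)//= [in RHS](bigD1 j)//= !mxE !eqxx /=.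
rewrite (eq_bigr (fun i => CRe (z 0 i) ^+ 2 + CIm (z 0 i) ^+ 2)).
  by rewrite mulr1 !CE; ring.
by move=> i /negbTE ij; rewrite !mxE /= ij mulr0 addr0.
Qed.

(** Openness of the domain in the plane of [w] and [z_j]. With [- CIm a] as its [t] argument,
    [wcoord] has as imaginary part the increment of the squared norm minus [CIm a], so
    [wcoord_small] applies. *)
Lemma hnorm2_lt n (z : 'rV[C]_n) j (t : R) : 0 < t -> exists2 r : R, 0 < r &
  forall a b : C, cmod a < r -> cmod b < r ->
  hnorm2 (z + b *: delta_mx 0 j) < hnorm2 z + t + CIm a.
Proof.
move=> t0; have [r r0 H] := wcoord_small (CRe (z 0 j)) (CIm (z 0 j)) t0.
exists r => // a b ar br; rewrite hnorm2D.
have [||||h _] := H (- CIm a) 0 (CRe b) (CIm b); rewrite ?normrN ?normr0//.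
- exact: le_lt_trans (CIm_le _) ar.
- exact: le_lt_trans (CRe_le _) br.
- exact: le_lt_trans (CIm_le _) br.
have := le_lt_trans (CIm_le _) h => /(le_lt_trans (ler_norm _)) /=; lra.
Qed.

Variables (n1 n2 : nat) (f : Uspace R n1 n2 -> C).
Hypothesis hf : holomorphicU f.

(** Here [u] is the direction of [w] and [v] that of [z_j]. The last hypothesis says that [piU] maps
    the real four-dimensional plane at [p] into the complex plane through [piU p], and [piUK]
    recovers [f] from its holomorphic transport. *)
Lemma plane_model_holo2 n (incl : R * heis R n -> Uspace R n1 n2)
    (xcoord : Uspace R n1 n2 -> 'rV[R]_(n + n)) p j (u v : Cspace R n1 n2) (r0 : R) :
  0 < r0 ->
  (forall a b : C, cmod a < r0 -> cmod b < r0 -> calU (piU p + a *: u + b *: v)) ->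
  (forall t s x y, piU (p + plane_incl incl j t s x y) =
    piU p + wcoord (xcoord p 0 (lshift n j)) (xcoord p 0 (rshift n j)) t s x y *: u
      + mkC x y *: v) ->
  exists F Fa Fb, exists r M : R,
    [/\ 0 < r, holo2 F Fa Fb r M & plane_model incl xcoord f p j F].
Proof.
move=> r00 HU Hpi.
have [r [M [r1 _ HF]]] := plane_holo2 r00 (fun a b ar br => hf (HU a b ar br)).
by do 3 eexists; exists r, M; split; [|exact: HF|] => // t s x y; rewrite -Hpi /comp piUK.
Qed.

End Siegel.

Lemma eq_tuple4 (A B C D : Type) (p q : A * B * C * D) :
  p.1.1.1 = q.1.1.1 -> p.1.1.2 = q.1.1.2 -> p.1.2 = q.1.2 -> p.2 = q.2 -> p = q.
Proof.
by case: p q => [[[? ?] ?] ?] [[[? ?] ?] ?] /= -> -> -> ->.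
Qed.

Theorem proposition1p1 (R : realType) (n1 n2 : nat)
  (hn1 : (0 < n1)%N) (hn2 : (0 < n2)%N)
  (f : Uspace R n1 n2 -> Cplx R) (hf : holomorphicU f) :
  satisfies_heat (@incl1 R n1 n2) (@xcoord1 R n1 n2) (@scrU R n1 n2) f /\
  satisfies_heat (@incl2 R n1 n2) (@xcoord2 R n1 n2) (@scrU R n1 n2) f.
Proof.
split; apply: heat_of_planes => //.
- move=> a [t [s x]] [t' [s' x']]; rewrite /incl1 /=.
  by congr (_, _, _, _); rewrite /= ?scaler0 ?addr0.
- by move=> [[[? ?] [? ?]] ?] [? [? ?]].
- move=> [[[t1 t2] [s1 x1]] [s2 x2]] j [t10 t20].
  have [r r0 H] := hnorm2_lt (zvec x1) j t10.
  apply: (@plane_model_holo2 R n1 n2 f hf n1 _ _ _ j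
    (1, 0, 0, 0) (0, 0, delta_mx 0 j, 0) r r0) => [a b ar br|t s x y].
    (* Membership is spelled out by components: the second inequality is that of the base point, and
       only the first depends on [a] and [b]. *)
    change (hnorm2 (zvec x1 + a *: 0 + b *: delta_mx 0 j) <
        CIm (mkC s1 (t1 + hnorm2 (zvec x1)) + a * 1 + b * 0) /\
      hnorm2 (zvec x2 + a *: 0 + b *: 0) <
        CIm (mkC s2 (t2 + hnorm2 (zvec x2)) + a * 0 + b * 0)).
    rewrite !scaler0 !mulr0 !addr0 mulr1 ltrDr; split=> //.
    by have := H a b ar br; rewrite CImD /= [t1 + _]addrC.
  apply: eq_tuple4; rewrite /= ?zvecD ?hnorm2D ?(mulr0, mulr1, scaler0, addr0) ?mxE //.
    by apply: Cext; rewrite !CE /=; ring.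
- move=> a [t [s x]] [t' [s' x']]; rewrite /incl2 /=.
  by congr (_, _, _, _); rewrite /= ?scaler0 ?addr0.
- by move=> [[[? ?] [? ?]] [? ?]] [? [? ?]].
- move=> [[[t1 t2] [s1 x1]] [s2 x2]] j [t10 t20].
  have [r r0 H] := hnorm2_lt (zvec x2) j t20.
  apply: (@plane_model_holo2 R n1 n2 f hf n2 _ _ _ j
    (0, 1, 0, 0) (0, 0, 0, delta_mx 0 j) r r0) => [a b ar br|t s x y].
    change (hnorm2 (zvec x1 + a *: 0 + b *: 0) <
        CIm (mkC s1 (t1 + hnorm2 (zvec x1)) + a * 0 + b * 0) /\
      hnorm2 (zvec x2 + a *: 0 + b *: delta_mx 0 j) <
        CIm (mkC s2 (t2 + hnorm2 (zvec x2)) + a * 1 + b * 0)).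
    rewrite !scaler0 !mulr0 !addr0 mulr1 ltrDr; split=> //.
    by have := H a b ar br; rewrite CImD /= [t2 + _]addrC.
  apply: eq_tuple4; rewrite /= ?zvecD ?hnorm2D ?(mulr0, mulr1, scaler0, addr0) ?mxE //.
    by apply: Cext; rewrite !CE /=; ring.
Qed.
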